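(* Let $d\in\mathbb{N}$, $d\ge3$. Then the free orthogonal quantum group $O_d^+$ (i.e. the augmented algebra $(\mathrm{Pol}(O_d^+),\epsilon)$) has none of the properties (GC), (NC) and (LK).
   Context: $\mathrm{Pol}(O_d^+)$ is the universal unital $^*$-algebra generated by selfadjoint elements $u_{jk}=u_{jk}^*$, $1\le j,k\le d$, subject to the relations that $u=(u_{jk})$ is unitary ($uu^*=u^*u=I$). Its character (counit) $\epsilon$ is the unital $^*$-homomorphism to $\mathbb{C}$ with $\epsilon(u_{jk})=\delta_{jk}$. Let $A$ be a unital $^*$-algebra with a character $\epsilon$, generated as a $^*$-algebra by the entries of a unitary matrix. Inner products are linear in the second argument; a representation on a Hilbert space $H$ means a unital $^*$-representation $\rho:A\to B(H)$. A $\rho$-$\epsilon$-cocycle is a linear map $\eta:A\to H$ with $\eta(ab)=\rho(a)\eta(b)+\eta(a)\epsilon(b)$. A Schürmann triple is $(\rho,\eta,\psi)$ with $\rho$ a representation, $\eta$ a $\rho$-$\epsilon$-cocycle and $\psi:A\to\mathbb{C}$ linear with $\psi(ab)=\psi(a)\epsilon(b)+\epsilon(a)\psi(b)+\langle\eta(a^* ),\eta(b)\rangle$ for all $a,b\in A$. A cocycle $\eta$ is Gaussian if $\rho=\epsilon(\cdot)\,\mathrm{id}_H$. For a representation $\rho$ on $H$ put $H_G=\{\xi\in H:\rho(a)\xi=\epsilon(a)\xi\ \forall a\in A\}$. A generating functional is a linear $\psi:A\to\mathbb{C}$ with $\psi(1)=0$, $\psi(a^* )=\overline{\psi(a)}$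 and $\psi(a^*a)\ge0$ for $a\in\ker\epsilon$. Every generating functional $\psi$ is part of a Schürmann triple $(\rho,\eta,\psi)$ with $\eta(A)$ dense in $H$, unique up to unitary equivalence (the associated triple). With $P_G$ the orthogonal projection onto $H_G$, put $\rho_G=\rho|_{H_G}$, $\rho_N=\rho|_{H_G^\perp}$, $\eta_G=P_G\eta$, $\eta_N=(I-P_G)\eta$. One says $\psi$ admits a Lévy–Khintchine decomposition if there exist generating functionals $\psi_G,\psi_N$ such that $(\rho_G,\eta_G,\psi_G)$ and $(\rho_N,\eta_N,\psi_N)$ are Schürmann triples. Property (LK): every generating functional on $(A,\epsilon)$ admits a Lévy–Khintchine decomposition. Property (GC): every Gaussian cocycle $\eta:A\to H$ (any Hilbert space $H$) can be completed to a Schürmann triple $(\epsilon(\cdot)\mathrm{id},\eta,\psi)$. Property (NC): every pair $(\rho,\eta)$ of a representation $\rho:A\to B(H)$ with $H_G=\{0\}$ and a $\rho$-$\epsilon$-cocycle $\eta:A\to H$ can be completed to a Schürmann triple $(\rho,\eta,\psi)$. *)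

(* Defs.v *)
From HB Require Import structures.
From mathcomp Require Import all_boot all_order all_algebra.
From mathcomp Require Import all_classical all_reals all_analysis.
From mathcomp Require Import complex ring lra.

Set Implicit Arguments.
Unset Strict Implicit.
Unset Printing Implicit Defensive.

Import Order.TTheory GRing.Theory Num.Theory.
Import numFieldNormedType.Exports.

Local Open Scope classical_set_scope.
Local Open Scope ring_scope.

HB.mixin Record Algebra_isStarAlgebra (C : numClosedFieldType) A
    of GRing.Algebra C A := {
  star : A -> A;
  starD : forall a b : A, star (a + b) = star a + star b;
  starZ : forall (c : C) (a : A), star (c *: a) = c^* *: star a;
  starM : forall a b : A, star (a * b) = star b * star a;
  starK : forall a : A, star (star a) = a
}.

#[short(type="starAlgType")]
HB.structure Definition StarAlgebra (C : numClosedFieldType) :=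
  {A of GRing.Algebra C A & Algebra_isStarAlgebra C A}.

Section ScalarStarAlgebra.
Variable C : numClosedFieldType.

Lemma star_scalarD (a b : C^o) : (a + b)^* = a^* + b^* :> C^o. Proof. exact: rmorphD. Qed.
Lemma star_scalarZ (c : C) (a : C^o) : (c *: a)^* = c^* *: (a^* : C^o) :> C^o.
Proof. exact: rmorphM. Qed.
Lemma star_scalarM (a b : C^o) : (a * b)^* = b^* * a^* :> C^o.
Proof. by rewrite mulrC; exact: rmorphM. Qed.
Lemma star_scalarK (a : C^o) : (a^*)^* = a :> C^o. Proof. exact: conjCK. Qed.

HB.instance Definition _ := Algebra_isStarAlgebra.Build C C^o star_scalarD star_scalarZ star_scalarM star_scalarK.

End ScalarStarAlgebra.

Record star_morphism (C : numClosedFieldType) (A B : starAlgType C) := StarMorphism {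
  star_morphism_fun :> {lrmorphism A -> B};
  star_morphism_star : forall a : A,
    star_morphism_fun (star a) = star (star_morphism_fun a)
}.

Definition character (C : numClosedFieldType) (A : starAlgType C) :=
  star_morphism A C^o.

HB.mixin Record CompleteNormedModule_isHilbert (C : numClosedFieldType) H
    of CompleteNormedModule C H := {
  inner : H -> H -> C;
  innerDr : forall x y z : H, inner x (y + z) = inner x y + inner x z;
  innerZr : forall (c : C) (x y : H), inner x (c *: y) = c * inner x y;
  inner_conj : forall x y : H, inner y x = (inner x y)^*;
  inner_norm : forall x : H, inner x x = `|x| ^+ 2
}.

#[short(type="hilbertType")]
HB.structure Definition Hilbert (C : numClosedFieldType) :=
  {H of CompleteNormedModule C H & CompleteNormedModule_isHilbert C H}.

Section InnerTheory.
Variables (C : numClosedFieldType) (H : hilbertType C).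
Implicit Types (x y z : H) (c : C).

Lemma innerDl x y z : inner (x + y) z = inner x z + inner y z.
Proof. by rewrite inner_conj innerDr rmorphD /= -!inner_conj. Qed.

Lemma innerZl c x y : inner (c *: x) y = c^* * inner x y.
Proof. by rewrite inner_conj innerZr rmorphM /= -inner_conj. Qed.

Lemma inner0r x : inner x 0 = 0.
Proof. by rewrite -[X in inner x X](scale0r (0 : H)) innerZr mul0r. Qed.

Lemma inner0l x : inner 0 x = 0.
Proof. by rewrite inner_conj inner0r conjC0. Qed.

Lemma innerNr x y : inner x (- y) = - inner x y.
Proof. by rewrite -scaleN1r innerZr mulN1r. Qed.

Lemma innerNl x y : inner (- x) y = - inner x y.
Proof. by rewrite inner_conj innerNr rmorphN /= -inner_conj. Qed.

Lemma innerBr x y z : inner x (y - z) = inner x y - inner x z.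
Proof. by rewrite innerDr innerNr. Qed.

Lemma innerBl x y z : inner (x - y) z = inner x z - inner y z.
Proof. by rewrite innerDl innerNl. Qed.

Lemma inner_eq0 x : inner x x = 0 -> x = 0.
Proof.
by move=> /eqP; rewrite inner_norm expf_eq0 /= normr_eq0 => /eqP.
Qed.

Lemma norm_subZ x y c :
  `|x - c *: y| ^+ 2 =
  `|x| ^+ 2 - c * inner x y - c^* * inner y x + `|c| ^+ 2 * `|y| ^+ 2.
Proof.
rewrite -!inner_norm innerBl !innerBr innerZr innerZl innerZl innerZr normCK.
by rewrite opprB mulrA [c^* * c]mulrC addrA addrAC -!addrA; congr (_ + _); rewrite addrCA [RHS]addrCA.
Qed.

Lemma norm_sub_proj x y : y != 0 ->
  `|x - (inner y x / `|y| ^+ 2) *: y| ^+ 2 =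
  `|x| ^+ 2 - `|inner y x| ^+ 2 / `|y| ^+ 2.
Proof.
move=> y0.
have yn : 0 < `|y| ^+ 2 by rewrite exprn_gt0 // normr_gt0.
have yr : ((`|y| ^+ 2)^-1)^* = (`|y| ^+ 2)^-1.
  by apply: conj_Creal; rewrite rpredV; apply: ger0_real; exact: ltW.
have ny : `|(`|y| ^+ 2)^-1| = (`|y| ^+ 2)^-1.
  by rewrite ger0_norm // invr_ge0 ltW.
rewrite norm_subZ rmorphM /= yr normrM exprMn ny (inner_conj x y) norm_conjC.
rewrite conjCK normCK.
set p := inner x y; set n := `|y| ^+ 2.
have n0 : n != 0 by rewrite gt_eqF.
by field.
Qed.

Lemma cauchy_schwarz_sq x y : `|inner x y| ^+ 2 <= `|x| ^+ 2 * `|y| ^+ 2.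
Proof.
have [->|y0] := eqVneq y 0.
  by rewrite inner0r !normr0 expr0n /= mulr0.
have : 0 <= `|x - (inner y x / `|y| ^+ 2) *: y| ^+ 2 by rewrite exprn_ge0.
rewrite norm_sub_proj // subr_ge0 ler_pdivrMr ?exprn_gt0 ?normr_gt0 //.
by rewrite inner_conj norm_conjC.
Qed.

Lemma cauchy_schwarz x y : `|inner x y| <= `|x| * `|y|.
Proof.
by rewrite -(@ler_pXn2r _ 2) ?nnegrE ?mulr_ge0 // exprMn; exact: cauchy_schwarz_sq.
Qed.

Lemma parallelogram x y :
  `|x + y| ^+ 2 + `|x - y| ^+ 2 = 2 * `|x| ^+ 2 + 2 * `|y| ^+ 2.
Proof.
rewrite -!inner_norm !innerDl !innerDr !innerNr !innerNl opprK.
by rewrite !mulr_natl !mulr2n; set a := inner x x; set b := inner x y;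
  set c := inner y x; set d := inner y y; rewrite addrACA
  [a + b + _]addrACA subrr addr0 [c + d + _]addrACA subrr add0r.
Qed.

Lemma inner_continuous x : continuous (inner x : H -> C^o).
Proof.
move=> y; apply/cvgrPdist_lt => e e0.
near=> z; rewrite -innerBr (le_lt_trans (cauchy_schwarz _ _)) //.
rewrite (@le_lt_trans _ _ ((`|x| + 1) * `|y - z|)) //.
  by rewrite ler_wpM2r // lerDl.
rewrite -ltr_pdivlMl ?ltr_wpDl //; near: z.
by apply: cvgr_dist_lt => //; rewrite mulr_gt0 // invr_gt0 ltr_wpDl.
Unshelve. all: by end_near. Qed.

End InnerTheory.

Record closed_subspace (C : numClosedFieldType) (H : hilbertType C) := ClosedSubspace {
  subspace_set :> set H;
  subspace0 : subspace_set 0;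
  subspaceZD : forall (c : C) (x y : H),
    subspace_set x -> subspace_set y -> subspace_set (c *: x + y);
  subspace_closed : closed subspace_set
}.

Section SubspaceHilbert.
Variables (C : numClosedFieldType) (H : hilbertType C) (K : closed_subspace H).

Definition in_subspace : {pred H} := fun x => `[< subspace_set K x >].

Lemma in_subspaceP x : reflect (subspace_set K x) (x \in in_subspace).
Proof. exact: asboolP. Qed.

Record subspace_sort := SubspaceElt {
  subspace_val :> H;
  subspace_valP : subspace_val \in in_subspace
}.

HB.instance Definition _ := [isSub for subspace_val].
HB.instance Definition _ := [Choice of subspace_sort by <:].

Lemma in_subspace_submod : subsemimod_closed in_subspace.
Proof.
split; first split.
- exact/in_subspaceP/subspace0.
- move=> x y /in_subspaceP Kx /in_subspaceP Ky; apply/in_subspaceP.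
  by rewrite -[x]scale1r; exact: subspaceZD.
- move=> c x /in_subspaceP Kx; apply/in_subspaceP.
  by rewrite -[_ *: _]addr0; apply: subspaceZD => //; exact: subspace0.
Qed.

HB.instance Definition _ := GRing.isSubmodClosed.Build C H in_subspace
  in_subspace_submod.
HB.instance Definition _ := [SubChoice_isSubLmodule of subspace_sort by <:].

Definition subspace_norm (x : subspace_sort) : C := `|subspace_val x|.
Lemma subspace_normD x y : subspace_norm (x + y) <= subspace_norm x + subspace_norm y.
Proof. exact: ler_normD. Qed.
Lemma subspace_normZ c x : subspace_norm (c *: x) = `|c| * subspace_norm x.
Proof. exact: normrZ. Qed.
Lemma subspace_norm0_eq0 x : subspace_norm x = 0 -> x = 0.
Proof. by move=> /normr0_eq0 x0; exact: val_inj. Qed.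

HB.instance Definition _ := @Lmodule_isNormed.Build C subspace_sort subspace_norm
  subspace_normD subspace_normZ subspace_norm0_eq0.

Lemma subspace_complete (F : set_system subspace_sort) :
  ProperFilter F -> cauchy F -> cvg F.
Proof.
move=> FF Fc.
have Gc : cauchy (subspace_val @ F).
  apply/cauchyP => e e0; have /cauchyP /(_ e e0) [y Fy] := Fc.
  exists (subspace_val y); rewrite /fmap /= /nbhs /=.
  by apply: filterS Fy => z; rewrite -!ball_normE.
have Gx : cvg (subspace_val @ F) :=
  @cauchy_cvg H _ (fmap_proper_filter subspace_val FF) Gc.
set x := lim _ in Gx.
have Kx : x \in in_subspace.
  apply/in_subspaceP; apply: (@closed_cvg _ H F FF subspace_val (subspace_set K)
    (@subspace_closed _ _ K) _ x Gx).
  by apply: nearW => y; exact/in_subspaceP/subspace_valP.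
apply/cvg_ex; exists (SubspaceElt Kx); apply/cvg_ballP => e e0.
by move/cvg_ballP: Gx => /(_ e e0); apply: filterS => z; rewrite -!ball_normE.
Qed.

HB.instance Definition _ := Uniform_isComplete.Build subspace_sort subspace_complete.

Definition subspace_inner (x y : subspace_sort) : C := inner (subspace_val x) (subspace_val y).
Lemma subspace_innerDr x y z : subspace_inner x (y + z) = subspace_inner x y + subspace_inner x z.
Proof. exact: innerDr. Qed.
Lemma subspace_innerZr c x y : subspace_inner x (c *: y) = c * subspace_inner x y.
Proof. exact: innerZr. Qed.
Lemma subspace_inner_conj x y : subspace_inner y x = (subspace_inner x y)^*.
Proof. exact: inner_conj. Qed.
Lemma subspace_inner_norm x : subspace_inner x x = `|x| ^+ 2.
Proof. exact: inner_norm. Qed.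

HB.instance Definition _ := @CompleteNormedModule_isHilbert.Build C subspace_sort
  subspace_inner subspace_innerDr subspace_innerZr subspace_inner_conj subspace_inner_norm.

Definition subspace_hilbert : hilbertType C := subspace_sort.

End SubspaceHilbert.

Section OrthogonalComplement.
Variables (C : numClosedFieldType) (H : hilbertType C) (K : closed_subspace H).

Definition ortho_set : set H :=
  [set x | forall y, subspace_set K y -> inner y x = 0].

Lemma ortho_set0 : ortho_set 0.
Proof. by move=> y _; rewrite inner0r. Qed.

Lemma ortho_setZD c x y : ortho_set x -> ortho_set y -> ortho_set (c *: x + y).
Proof.
by move=> Ox Oy z Kz; rewrite innerDr innerZr Ox // Oy // mulr0 addr0.
Qed.

Lemma ortho_set_closed : closed ortho_set.
Proof.
rewrite (_ : ortho_set =
  \bigcap_(y in subspace_set K) ((inner y : H -> C^o) @^-1` [set 0])); last first.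
  by apply/seteqP; split=> x /= Ox y Ky; apply: Ox.
apply: closed_bigI => y _; apply: closed_comp; last exact/accessible_closed_set1/hausdorff_accessible/norm_hausdorff.
by move=> x _; exact: inner_continuous.
Qed.

Definition ortho := ClosedSubspace ortho_set0 ortho_setZD ortho_set_closed.

End OrthogonalComplement.

Section Projection.
Variable R : realType.
Local Notation C := (complex R).
Variables (H : hilbertType C) (K : closed_subspace H).

Lemma projection_theorem (x : H) :
  exists2 y, subspace_set K y & subspace_set (ortho K) (x - y).
Proof.
have Kmid y z : subspace_set K y -> subspace_set K z ->
    subspace_set K (2^-1 *: (y + z)).
  move=> Ky Kz; rewrite scalerDr; apply: subspaceZD => //.
  by rewrite -[_ *: _]addr0; apply: subspaceZD => //; exact: subspace0.
pose q (y : H) : R := complex.Re (`|x - y| ^+ 2).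
have qE y : `|x - y| ^+ 2 = (q y)%:C%C.
  have : 0 <= `|x - y| ^+ 2 by rewrite exprn_ge0.
  rewrite /q; case: (`|x - y| ^+ 2) => a b.
  by rewrite lecE /= => /andP[/eqP -> _] /=.
have q0 y : 0 <= q y by rewrite -lecR -qE exprn_ge0.
pose Q : set R := q @` subspace_set K.
have hQ : has_inf Q.
  split; first by exists (q 0), 0 => //; exact: subspace0.
  by exists 0 => _ [y _ <-].
pose del := inf Q.
have del_le y : subspace_set K y -> del <= q y.
  by move=> Ky; apply: ge_inf; [case: hQ|exists y].
have mid y z : subspace_set K y -> subspace_set K z ->
    `|y - z| ^+ 2 <= (2 * q y + 2 * q z - 4 * del)%:C%C.
  move=> Ky Kz.
  have := parallelogram (x - y) (x - z).
  have -> : x - y - (x - z) = - (y - z) by rewrite !opprB addrC addrA subrK.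
  rewrite normrN.
  have -> : x - y + (x - z) = 2 *: (x - 2^-1 *: (y + z)).
    rewrite scalerBr scalerA mulfV ?pnatr_eq0 // scale1r scaler_nat mulr2n.
    by rewrite addrACA opprD.
  rewrite normrZ normr_nat exprMn !qE => E.
  have -> : `|y - z| ^+ 2 =
      (2 * q y + 2 * q z - 4 * q (2^-1 *: (y + z)))%:C%C.
    rewrite !(rmorphB, rmorphD, rmorphM) !rmorph1 /=.
    by apply/eqP; rewrite -subr_eq0; apply/eqP; move/eqP: E;
      rewrite -subr_eq0 => /eqP <-; ring.
  by rewrite lecR lerB // ler_pM2l // del_le //; exact: Kmid.
pose F := filter_from [set e : R | 0 < e]
  (fun e => [set y | subspace_set K y /\ q y < del + e]).
have FF : ProperFilter F.
  apply: filter_from_proper; last first.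
    move=> e /= e0; have [_ [y Ky <-] ye] := inf_adherent e0 hQ.
    by exists y.
  apply: filter_from_filter; first by exists 1; rewrite /= ltr01.
  move=> e f /= e0 f0; exists (Num.min e f) => /=; first by rewrite lt_min e0 f0.
  move=> y [Ky ye]; split; split => //; apply: (lt_le_trans ye);
    by rewrite lerD2l ge_min lexx ?orbT.
have posC (e : C) : 0 < e -> exists2 f : R, 0 < f & e = f%:C%C.
  by case: e => a b; rewrite ltcE /= => /andP[/eqP -> a0]; exists a.
have Fc : cauchy F.
  apply/cauchyP => _ /posC [e e0 ->].
  have d0 : 0 < e ^+ 2 / 4 by rewrite divr_gt0 ?exprn_gt0.
  have [_ [y Ky <-] ye] := inf_adherent d0 hQ.
  exists y; exists (e ^+ 2 / 4) => //= z [Kz ze].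
  have e0C : 0 < e%:C%C by rewrite -(rmorph0 (real_complex R)) ltcR.
  rewrite -ball_normE /ball_ /= -(@ltr_pXn2r _ 2) ?nnegrE ?(ltW e0C) //.
  apply: le_lt_trans (mid y z Ky Kz) _.
  rewrite -rmorphXn /= ltcR.
  by rewrite -/del in ye *; lra.
have Fy : cvg F := @cauchy_cvg H _ FF Fc.
set y := lim _ in Fy.
have FK : \forall z \near F, subspace_set K z by exists 1 => //= z [].
exists y.
  by apply: (@closed_cvg _ H F FF id (subspace_set K)
    (@subspace_closed _ _ K) FK y Fy).
move=> w Kw; apply/eqP; rewrite -normr_eq0; apply/negP => /negP a_neq0.
have [w0|w0] := eqVneq w 0; first by rewrite w0 inner0l normr0 eqxx in a_neq0.
have /posC [a a0 aE] : 0 < `|inner w (x - y)| by rewrite lt0r a_neq0 normr_ge0.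
have wn : 0 < `|w| by rewrite normr_gt0.
have /posC [n n0 nE] : 0 < `|w| ^+ 2 by rewrite exprn_gt0.
have near1 : \forall z \near F, q z < del + a ^+ 2 / (4 * n).
  exists (a ^+ 2 / (4 * n)) => /=; first by rewrite divr_gt0 ?exprn_gt0 ?mulr_gt0.
  by move=> z [].
have near2 : \forall z \near F, `|y - z| < `|inner w (x - y)| / 2 / `|w|.
  have h e : 0 < e -> F (ball y e) by move=> e0; apply: Fy; exact: nbhsx_ballx.
  rewrite -ball_normE in h; apply: h.
  by rewrite !divr_gt0 // lt0r a_neq0 normr_ge0.
have [z [[Kz qz] yz]] := filter_ex (filterI (filterI FK near1) near2).
have : `|inner w (x - y)| < `|inner w (x - y)|; last by rewrite ltxx.
have -> : x - y = (x - z) - (y - z) by rewrite opprB addrA subrK.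
rewrite innerBr (le_lt_trans (ler_normB _ _)) //.
rewrite -innerBr opprB addrA subrK [ltRHS]splitr ltrD //; last first.
  rewrite (le_lt_trans (cauchy_schwarz _ _)) //.
  by rewrite mulrC -ltr_pdivlMr.
rewrite -(@ltr_pXn2r _ 2) ?nnegrE ?divr_ge0 //.
have Kzw : subspace_set K (inner w (x - z) / `|w| ^+ 2 *: w + z).
  exact: subspaceZD.
have := del_le _ Kzw; rewrite -lecR -qE.
have -> : x - (inner w (x - z) / `|w| ^+ 2 *: w + z) =
    x - z - inner w (x - z) / `|w| ^+ 2 *: w by rewrite opprD addrA addrAC.
rewrite norm_sub_proj // qE lerBrDr -lerBrDl nE.
rewrite ler_pdivrMr ?ltcR // => /le_lt_trans; apply.
rewrite aE -[2 in ltRHS](rmorph_nat (real_complex R)) -rmorphV ?unitfE ?pnatr_eq0 //.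
rewrite -!(rmorphB, rmorphM, rmorphXn) ltcR -ltr_pdivlMr //.
rewrite ltrBlDl (lt_le_trans qz) // lerD2l.
rewrite (_ : (a * 2^-1) ^+ 2 / n = a ^+ 2 / (4 * n)) //.
by have := lt0r_neq0 n0; move=> n_neq0; field.
Qed.

Lemma subspace_ortho_disj (x : H) :
  subspace_set K x -> subspace_set (ortho K) x -> x = 0.
Proof. by move=> Kx Ox; apply: inner_eq0; exact: Ox. Qed.

Definition orthoproj (x : H) : H := s2val (cid2 (projection_theorem x)).

Lemma orthoproj_in (x : H) : subspace_set K (orthoproj x).
Proof. by rewrite /orthoproj; case: cid2. Qed.

Lemma orthoproj_ortho (x : H) : subspace_set (ortho K) (x - orthoproj x).
Proof. by rewrite /orthoproj; case: cid2. Qed.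

Lemma orthoproj_unique (x y : H) :
  subspace_set K y -> subspace_set (ortho K) (x - y) -> orthoproj x = y.
Proof.
move=> Ky Oy; apply/eqP; rewrite -subr_eq0; apply/eqP; apply: subspace_ortho_disj.
  by rewrite addrC -scaleN1r; apply: subspaceZD => //; exact: orthoproj_in.
have -> : orthoproj x - y = - 1 *: (x - orthoproj x) + (x - y).
  by rewrite scaleN1r opprB addrA subrK.
by apply: subspaceZD => //; exact: orthoproj_ortho.
Qed.

End Projection.

Section Schuermann.
Variable C : numClosedFieldType.

Record representation (A : starAlgType C) (H : hilbertType C) := Representation {
  rep_op :> A -> H -> H;
  rep_op_linear : forall a, linear (rep_op a);
  rep_op_bounded : forall a, exists M : C, forall x, `|rep_op a x| <= M * `|x|;
  rep_linear : forall x, linear (rep_op^~ x);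
  rep1 : forall x, rep_op 1 x = x;
  repM : forall a b x, rep_op (a * b) x = rep_op a (rep_op b x);
  rep_star : forall a x y, inner (rep_op (star a) x) y = inner x (rep_op a y)
}.

HB.instance Definition _ (A : starAlgType C) (H : hilbertType C)
    (rho : representation A H) (a : A) :=
  GRing.isLinear.Build C H H *:%R (rho a) (rep_op_linear rho a).

Lemma rep_continuous (A : starAlgType C) (H : hilbertType C)
  (rho : representation A H) (a : A) : continuous (rho a).
Proof.
have [M rM] := rep_op_bounded rho a.
apply: bounded_linear_continuous; apply/ex_bound; exists `|M|.
apply/nbhs_norm0P; exists 1 => //= x x1.
have rx := rM x; apply: (le_trans rx).
rewrite -(ger0_norm (le_trans (normr_ge0 _) rx)) normrM normr_id.
by rewrite ler_piMr // ltW.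
Qed.

Variables (A : starAlgType C) (eps : character A).

Section OnHilbert.
Variable H : hilbertType C.

Definition is_cocycle (rho : representation A H) (eta : A -> H) : Prop :=
  linear eta /\
  forall a b, eta (a * b) = rho a (eta b) + (eps b : C) *: eta a.

Definition is_schurmann_triple
    (rho : representation A H) (eta : A -> H) (psi : A -> C) : Prop :=
  [/\ is_cocycle rho eta, scalar psi &
    forall a b, psi (a * b) =
      psi a * eps b + eps a * psi b + inner (eta (star a)) (eta b)].

Definition character_op (a : A) (x : H) : H := (eps a : C) *: x.

Lemma character_op_linear a : linear (character_op a).
Proof.
by move=> c x y; rewrite /character_op scalerDr !scalerA mulrC.
Qed.
Lemma character_op_bounded a :
  exists M : C, forall x, `|character_op a x| <= M * `|x|.
Proof. by exists `|eps a : C| => x; rewrite normrZ. Qed.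
Lemma character_linear x : linear (character_op^~ x).
Proof.
by move=> c a b; rewrite /character_op linearP scalerDl scalerA.
Qed.
Lemma character1 x : character_op 1 x = x.
Proof. by rewrite /character_op rmorph1 scale1r. Qed.
Lemma characterM a b x : character_op (a * b) x = character_op a (character_op b x).
Proof. by rewrite /character_op rmorphM scalerA. Qed.
Lemma character_star a x y :
  inner (character_op (star a) x) y = inner x (character_op a y).
Proof.
by rewrite /character_op innerZl innerZr star_morphism_star /star /= conjCK.
Qed.

Definition character_rep : representation A H :=
  Representation character_op_linear character_op_bounded character_linear
    character1 characterM character_star.

Section FixedSpace.
Variable rho : representation A H.

(* H_G *)
Definition gaussian_set : set H := [set x | forall a, rho a x = (eps a : C) *: x].

Lemma gaussian_set0 : gaussian_set 0.
Proof. by move=> a; rewrite linear0 scaler0. Qed.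
Lemma gaussian_setZD c x y :
  gaussian_set x -> gaussian_set y -> gaussian_set (c *: x + y).
Proof.
by move=> Gx Gy a; rewrite rep_op_linear Gx Gy scalerDr !scalerA mulrC.
Qed.
Lemma gaussian_set_closed : closed gaussian_set.
Proof.
rewrite (_ : gaussian_set =
  \bigcap_(a in setT) ((rho a \- character_rep a) @^-1` [set 0])); last first.
  apply/seteqP; split=> x /= Gx a; first move=> _.
    by apply/eqP; rewrite subr_eq0; apply/eqP; exact: Gx.
  by apply/eqP; rewrite -subr_eq0; apply/eqP; exact: (Gx a I).
apply: closed_bigI => a _; apply: closed_comp; last first.
  exact/accessible_closed_set1/hausdorff_accessible/norm_hausdorff.
by move=> x _; apply: cvgB; exact: rep_continuous.
Qed.

Definition gaussian_part : closed_subspace H :=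
  ClosedSubspace gaussian_set0 gaussian_setZD gaussian_set_closed.

Lemma gaussian_part_invariant a x :
  subspace_set gaussian_part x -> subspace_set gaussian_part (rho a x).
Proof.
by move=> Gx; rewrite (Gx a) -[_ *: _]addr0; apply: subspaceZD => //; exact: subspace0.
Qed.

Lemma ortho_invariant (K : closed_subspace H) :
  (forall a x, subspace_set K x -> subspace_set K (rho a x)) ->
  forall a x, subspace_set (ortho K) x -> subspace_set (ortho K) (rho a x).
Proof.
move=> invK a x Ox /= y Ky; rewrite -rep_star; apply: Ox; exact: invK.
Qed.

End FixedSpace.

Section Restriction.
Variables (rho : representation A H) (K : closed_subspace H).
Hypothesis invK : forall a x, subspace_set K x -> subspace_set K (rho a x).

Definition subspace_elt (x : H) (Kx : subspace_set K x) : subspace_hilbert K :=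
  SubspaceElt (introT (in_subspaceP K x) Kx).

Definition restr_op (a : A) (x : subspace_hilbert K) : subspace_hilbert K :=
  subspace_elt (invK a (elimT (in_subspaceP K _) (subspace_valP x))).

Lemma restr_op_linear a : linear (restr_op a).
Proof. by move=> c x y; apply: val_inj; exact: (rep_op_linear rho). Qed.
Lemma restr_op_bounded a :
  exists M : C, forall x, `|restr_op a x| <= M * `|x|.
Proof. by have [M rM] := rep_op_bounded rho a; exists M => x; exact: rM. Qed.
Lemma restr_linear x : linear (restr_op^~ x).
Proof. by move=> c a b; apply: val_inj; exact: (rep_linear rho). Qed.
Lemma restr1 x : restr_op 1 x = x.
Proof. by apply: val_inj; exact: rep1. Qed.
Lemma restrM a b x : restr_op (a * b) x = restr_op a (restr_op b x).
Proof. by apply: val_inj; exact: repM. Qed.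
Lemma restr_star a x y :
  inner (restr_op (star a) x) y = inner x (restr_op a y).
Proof. exact: rep_star. Qed.

Definition rep_restr : representation A (subspace_hilbert K) :=
  Representation restr_op_linear restr_op_bounded restr_linear
    restr1 restrM restr_star.

End Restriction.
End OnHilbert.

Definition generating_functional (psi : A -> C) : Prop :=
  [/\ scalar psi, psi 1 = 0, forall a, psi (star a) = (psi a)^* &
    forall a, eps a = 0 -> 0 <= psi (star a * a)].

Definition property_GC : Prop :=
  forall (H : hilbertType C) (eta : A -> H),
    is_cocycle (character_rep H) eta ->
    exists psi : A -> C, is_schurmann_triple (character_rep H) eta psi.

Definition property_NC : Prop :=
  forall (H : hilbertType C) (rho : representation A H) (eta : A -> H),
    gaussian_set rho = [set 0] -> is_cocycle rho eta ->
    exists psi : A -> C, is_schurmann_triple rho eta psi.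

End Schuermann.

Section LevyKhintchine.
Variables (R : realType).
Local Notation C := (complex R).
Variables (A : starAlgType C) (eps : character A).

Section Decomposition.
Variables (H : hilbertType C) (rho : representation A H) (eta : A -> H).

Local Notation HG := (gaussian_part eps rho).

Definition rho_G : representation A (subspace_hilbert HG) :=
  rep_restr (@gaussian_part_invariant _ _ eps _ rho).

Definition rho_N : representation A (subspace_hilbert (ortho HG)) :=
  rep_restr (ortho_invariant (@gaussian_part_invariant _ _ eps _ rho)).

Definition eta_G (a : A) : subspace_hilbert HG :=
  subspace_elt (@orthoproj_in R H HG (eta a)).

Definition eta_N (a : A) : subspace_hilbert (ortho HG) :=
  subspace_elt (@orthoproj_ortho R H HG (eta a)).

End Decomposition.

Definition associated_triple (H : hilbertType C) (rho : representation A H)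
    (eta : A -> H) (psi : A -> C) : Prop :=
  is_schurmann_triple eps rho eta psi /\ dense (range eta).

(* An associated triple exists and is unique up to unitary equivalence, which
   transports decompositions: quantifying over all of them is the same as fixing
   one. *)
Definition admits_LK (psi : A -> C) : Prop :=
  forall (H : hilbertType C) (rho : representation A H) (eta : A -> H),
    associated_triple rho eta psi ->
    exists psi_G psi_N : A -> C,
      [/\ generating_functional eps psi_G, generating_functional eps psi_N,
          is_schurmann_triple eps (rho_G rho) (eta_G rho eta) psi_G &
          is_schurmann_triple eps (rho_N rho) (eta_N rho eta) psi_N].

Definition property_LK : Prop :=
  forall psi : A -> C, generating_functional eps psi -> admits_LK psi.

End LevyKhintchine.

(* A universal unital *-algebra is built as terms modulo the least congruence
   [star_cong] containing the *-algebra axioms and the defining relations; scalars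
   act by multiplication by [tconst], and -s is [tmul (tconst (-1)) s]. *)

Inductive star_term (C I : Type) : Type :=
| tgen of I
| tconst of C
| tadd of star_term C I & star_term C I
| tmul of star_term C I & star_term C I
| tstar of star_term C I.
Arguments tgen {C I}.
Arguments tconst {C I}.

Section StarCongruence.
Variables (C : numClosedFieldType) (I : Type).
Local Notation term := (star_term C I).
Variable rel : term -> term -> Prop.

Inductive star_cong : term -> term -> Prop :=
| cong_rel s t : rel s t -> star_cong s t
| cong_refl s : star_cong s s
| cong_sym s t : star_cong s t -> star_cong t s
| cong_trans s t u : star_cong s t -> star_cong t u -> star_cong s u
| cong_add s s' t t' :
    star_cong s s' -> star_cong t t' -> star_cong (tadd s t) (tadd s' t')
| cong_mul s s' t t' :
    star_cong s s' -> star_cong t t' -> star_cong (tmul s t) (tmul s' t')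
| cong_star s s' : star_cong s s' -> star_cong (tstar s) (tstar s')
| cong_addA s t u : star_cong (tadd s (tadd t u)) (tadd (tadd s t) u)
| cong_addC s t : star_cong (tadd s t) (tadd t s)
| cong_add0 s : star_cong (tadd (tconst 0) s) s
| cong_mulA s t u : star_cong (tmul s (tmul t u)) (tmul (tmul s t) u)
| cong_mul1 s : star_cong (tmul (tconst 1) s) s
| cong_mul0 s : star_cong (tmul (tconst 0) s) (tconst 0)
| cong_mulDl s t u : star_cong (tmul (tadd s t) u) (tadd (tmul s u) (tmul t u))
| cong_mulDr s t u : star_cong (tmul s (tadd t u)) (tadd (tmul s t) (tmul s u))
| cong_constD c e : star_cong (tconst (c + e)) (tadd (tconst c) (tconst e))
| cong_constM c e : star_cong (tconst (c * e)) (tmul (tconst c) (tconst e))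
| cong_constC c s : star_cong (tmul (tconst c) s) (tmul s (tconst c))
| cong_starD s t : star_cong (tstar (tadd s t)) (tadd (tstar s) (tstar t))
| cong_starM s t : star_cong (tstar (tmul s t)) (tmul (tstar t) (tstar s))
| cong_starK s : star_cong (tstar (tstar s)) s
| cong_star_const c : star_cong (tstar (tconst c)) (tconst c^*).

Section Eval.
Variables (B : starAlgType C) (v : I -> B).

Fixpoint star_eval (t : term) : B :=
  match t with
  | tgen i => v i
  | tconst c => c%:A
  | tadd s t => star_eval s + star_eval t
  | tmul s t => star_eval s * star_eval t
  | tstar s => star (star_eval s)
  end.

Lemma star1 : star (1 : B) = 1.
Proof.
by rewrite -[star 1]mul1r -{1}[1](starK (s := B)) -starM mul1r starK.
Qed.

Hypothesis v_rel : forall s t, rel s t -> star_eval s = star_eval t.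

Lemma star_eval_cong s t : star_cong s t -> star_eval s = star_eval t.
Proof.
elim=> //=.
- by move=> ? ? ? _ -> _ ->.
- by move=> ? ? ? ? _ -> _ ->.
- by move=> ? ? ? ? _ -> _ ->.
- by move=> ? ? _ ->.
- by move=> *; rewrite addrA.
- by move=> *; rewrite addrC.
- by move=> *; rewrite scale0r add0r.
- by move=> *; rewrite mulrA.
- by move=> *; rewrite scale1r mul1r.
- by move=> *; rewrite scale0r mul0r.
- by move=> *; rewrite mulrDl.
- by move=> *; rewrite mulrDr.
- by move=> *; rewrite scalerDl.
- by move=> *; rewrite -scalerAl mul1r scalerA.
- by move=> *; rewrite -scalerAl -scalerAr mul1r mulr1.
- by move=> *; rewrite starD.
- by move=> *; rewrite starM.
- by move=> *; rewrite starK.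
- by move=> *; rewrite starZ star1.
Qed.

End Eval.
End StarCongruence.

Section FreeOrthogonal.
Variable C : numClosedFieldType.
Variable d : nat.

Local Notation term := (star_term C ('I_d * 'I_d)).
Local Notation u j k := (tgen (j, k) : term).

(* entrywise: u_jk^* = u_jk, u u^* = I and u^* u = I *)
Inductive o_plus_rel : term -> term -> Prop :=
| o_plus_selfadjoint j k : o_plus_rel (tstar (u j k)) (u j k)
| o_plus_unitaryl j l :
    o_plus_rel (\big[@tadd _ _/tconst 0]_(k < d) tmul (u j k) (tstar (u l k)))
               (tconst (j == l)%:R)
| o_plus_unitaryr j l :
    o_plus_rel (\big[@tadd _ _/tconst 0]_(k < d) tmul (tstar (u k j)) (u k l))
               (tconst (j == l)%:R).

HB.instance Definition _ := gen_eqMixin term.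
HB.instance Definition _ := gen_choiceMixin term.

Definition o_plus_eqv (s t : term) : bool := `[< star_cong o_plus_rel s t >].

Lemma o_plus_eqvP s t : reflect (star_cong o_plus_rel s t) (o_plus_eqv s t).
Proof. exact: asboolP. Qed.

Lemma o_plus_eqv_refl : reflexive o_plus_eqv.
Proof. by move=> s; apply/o_plus_eqvP; exact: cong_refl. Qed.
Lemma o_plus_eqv_sym : symmetric o_plus_eqv.
Proof.
by move=> s t; apply/o_plus_eqvP/o_plus_eqvP; exact: cong_sym.
Qed.
Lemma o_plus_eqv_trans : transitive o_plus_eqv.
Proof.
move=> t s r /o_plus_eqvP st /o_plus_eqvP tr; apply/o_plus_eqvP.
exact: cong_trans tr.
Qed.

Canonical o_plus_equiv :=
  EquivRel o_plus_eqv o_plus_eqv_refl o_plus_eqv_sym o_plus_eqv_trans.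

Definition pol_O_plus := {eq_quot o_plus_equiv}%qT.

HB.instance Definition _ := Choice.on pol_O_plus.
HB.instance Definition _ := EqQuotient.on pol_O_plus.

Definition opi (s : term) : pol_O_plus := (\pi_(pol_O_plus) s)%qT.

Lemma opi_eq s t : opi s = opi t <-> star_cong o_plus_rel s t.
Proof.
split=> [/eqmodP/o_plus_eqvP // | st].
by apply/eqmodP; rewrite /=; apply/o_plus_eqvP.
Qed.

Lemma opi_surj (x : pol_O_plus) : exists s, x = opi s.
Proof. by exists (repr x); rewrite /opi reprK. Qed.

Lemma opi_repr s : star_cong o_plus_rel (repr (opi s)) s.
Proof. by apply/opi_eq; rewrite /opi reprK. Qed.

Definition oadd (x y : pol_O_plus) := opi (tadd (repr x) (repr y)).
Definition oopp (x : pol_O_plus) := opi (tmul (tconst (-1)) (repr x)).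
Definition omul (x y : pol_O_plus) := opi (tmul (repr x) (repr y)).
Definition oscale (c : C) (x : pol_O_plus) := opi (tmul (tconst c) (repr x)).
Definition ostar (x : pol_O_plus) := opi (tstar (repr x)).

Lemma oaddE s t : oadd (opi s) (opi t) = opi (tadd s t).
Proof. by apply/opi_eq/cong_add; exact: opi_repr. Qed.
Lemma ooppE s : oopp (opi s) = opi (tmul (tconst (-1)) s).
Proof. by apply/opi_eq/cong_mul; [exact: cong_refl | exact: opi_repr]. Qed.
Lemma omulE s t : omul (opi s) (opi t) = opi (tmul s t).
Proof. by apply/opi_eq/cong_mul; exact: opi_repr. Qed.
Lemma oscaleE c s : oscale c (opi s) = opi (tmul (tconst c) s).
Proof. by apply/opi_eq/cong_mul; [exact: cong_refl | exact: opi_repr]. Qed.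
Lemma ostarE s : ostar (opi s) = opi (tstar s).
Proof. by apply/opi_eq/cong_star; exact: opi_repr. Qed.

Let oE := (oaddE, ooppE, omulE, oscaleE, ostarE).

Lemma oaddA : associative oadd.
Proof.
move=> x y z; have [s ->] := opi_surj x; have [t ->] := opi_surj y.
by have [r ->] := opi_surj z; rewrite !oE; apply/opi_eq; exact: cong_addA.
Qed.
Lemma oaddC : commutative oadd.
Proof.
move=> x y; have [s ->] := opi_surj x; have [t ->] := opi_surj y.
by rewrite !oE; apply/opi_eq; exact: cong_addC.
Qed.
Lemma oadd0 : left_id (opi (tconst 0)) oadd.
Proof.
by move=> x; have [s ->] := opi_surj x; rewrite !oE; apply/opi_eq; exact: cong_add0.
Qed.

Lemma oscaleA a b x : oscale a (oscale b x) = oscale (a * b) x.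
Proof.
have [s ->] := opi_surj x; rewrite !oE; apply/opi_eq.
apply: cong_trans (cong_mulA _ _ _ _) _.
by apply: cong_mul; [apply/cong_sym/cong_constM | exact: cong_refl].
Qed.
Lemma oscale1 : left_id 1 oscale.
Proof.
by move=> x; have [s ->] := opi_surj x; rewrite !oE; apply/opi_eq; exact: cong_mul1.
Qed.
Lemma oscaleDr : right_distributive oscale oadd.
Proof.
move=> c x y; have [s ->] := opi_surj x; have [t ->] := opi_surj y.
by rewrite !oE; apply/opi_eq; exact: cong_mulDr.
Qed.
Lemma oscaleDl x a b : oscale (a + b) x = oadd (oscale a x) (oscale b x).
Proof.
have [s ->] := opi_surj x; rewrite !oE; apply/opi_eq.
apply: cong_trans (cong_mulDl _ _ _ _).
by apply: cong_mul; [exact: cong_constD | exact: cong_refl].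
Qed.
Lemma oaddN : left_inverse (opi (tconst 0)) oopp oadd.
Proof.
move=> x; have [s ->] := opi_surj x; rewrite !oE; apply/opi_eq.
apply: (@cong_trans _ _ _ _ (tmul (tconst 0) s)); last exact: cong_mul0.
apply: (@cong_trans _ _ _ _ (tadd (tmul (tconst (-1)) s) (tmul (tconst 1) s))).
  by apply: cong_add; [exact: cong_refl | apply/cong_sym/cong_mul1].
apply: cong_trans (cong_sym (cong_mulDl _ _ _ _)) _.
apply: cong_mul (cong_refl _ _).
by have := cong_constD o_plus_rel (-1) 1; rewrite addNr => /cong_sym.
Qed.

Lemma omulA : associative omul.
Proof.
move=> x y z; have [s ->] := opi_surj x; have [t ->] := opi_surj y.
by have [r ->] := opi_surj z; rewrite !oE; apply/opi_eq; exact: cong_mulA.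
Qed.
Lemma omul1l : left_id (opi (tconst 1)) omul.
Proof.
by move=> x; have [s ->] := opi_surj x; rewrite !oE; apply/opi_eq; exact: cong_mul1.
Qed.
Lemma omul1r : right_id (opi (tconst 1)) omul.
Proof.
move=> x; have [s ->] := opi_surj x; rewrite !oE; apply/opi_eq.
exact: cong_trans (cong_sym (cong_constC _ _ _)) (cong_mul1 _ _).
Qed.
Lemma omulDl : left_distributive omul oadd.
Proof.
move=> x y z; have [s ->] := opi_surj x; have [t ->] := opi_surj y.
by have [r ->] := opi_surj z; rewrite !oE; apply/opi_eq; exact: cong_mulDl.
Qed.
Lemma omulDr : right_distributive omul oadd.
Proof.
move=> x y z; have [s ->] := opi_surj x; have [t ->] := opi_surj y.
by have [r ->] := opi_surj z; rewrite !oE; apply/opi_eq; exact: cong_mulDr.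
Qed.
Lemma oscaleAl c x y : oscale c (omul x y) = omul (oscale c x) y.
Proof.
have [s ->] := opi_surj x; have [t ->] := opi_surj y.
by rewrite !oE; apply/opi_eq; exact: cong_mulA.
Qed.
Lemma oscaleAr c x y : oscale c (omul x y) = omul x (oscale c y).
Proof.
have [s ->] := opi_surj x; have [t ->] := opi_surj y.
rewrite !oE; apply/opi_eq; apply: cong_trans (cong_mulA _ _ _ _) _.
apply: cong_trans (cong_mul (cong_constC _ _ _) (cong_refl _ _)) _.
exact: cong_sym (cong_mulA _ _ _ _).
Qed.

Lemma ostarD x y : ostar (oadd x y) = oadd (ostar x) (ostar y).
Proof.
have [s ->] := opi_surj x; have [t ->] := opi_surj y.
by rewrite !oE; apply/opi_eq; exact: cong_starD.
Qed.
Lemma ostarZ c x : ostar (oscale c x) = oscale c^* (ostar x).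
Proof.
have [s ->] := opi_surj x; rewrite !oE; apply/opi_eq.
apply: cong_trans (cong_starM _ _ _) _.
apply: cong_trans (cong_sym (cong_constC _ _ _)).
by apply: cong_mul; [exact: cong_refl | exact: cong_star_const].
Qed.
Lemma ostarM x y : ostar (omul x y) = omul (ostar y) (ostar x).
Proof.
have [s ->] := opi_surj x; have [t ->] := opi_surj y.
by rewrite !oE; apply/opi_eq; exact: cong_starM.
Qed.
Lemma ostarK x : ostar (ostar x) = x.
Proof.
by have [s ->] := opi_surj x; rewrite !oE; apply/opi_eq; exact: cong_starK.
Qed.

Section OPlusEval.
Variables (B : starAlgType C) (v : 'I_d -> 'I_d -> B).
Hypothesis v_selfadjoint : forall j k, star (v j k) = v j k.
Hypothesis v_unitaryl : forall j l,
  \sum_(k < d) v j k * star (v l k) = (j == l)%:R.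
Hypothesis v_unitaryr : forall j l,
  \sum_(k < d) star (v k j) * v k l = (j == l)%:R.

Local Notation ev := (star_eval (fun jk => v jk.1 jk.2)).

Lemma star_eval_sum (F : 'I_d -> term) :
  ev (\big[@tadd _ _/tconst 0]_(k < d) F k) = \sum_(k < d) ev (F k).
Proof. by elim/big_ind2: _ => //= [|? ? ? ? -> ->]; rewrite ?scale0r. Qed.

Lemma o_plus_eval_rel s t : o_plus_rel s t -> ev s = ev t.
Proof.
case=> [j k|j l|j l] /=; first exact: v_selfadjoint.
- by rewrite star_eval_sum /= v_unitaryl scaler_nat.
- by rewrite star_eval_sum /= v_unitaryr scaler_nat.
Qed.

Lemma o_plus_eval_cong s t : star_cong o_plus_rel s t -> ev s = ev t.
Proof. exact: star_eval_cong o_plus_eval_rel _ _. Qed.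

End OPlusEval.

Lemma delta_unitaryl (j l : 'I_d) :
  \sum_(k < d) (j == k)%:R * star ((l == k)%:R : C^o) = (j == l)%:R :> C^o.
Proof.
rewrite (bigD1 j) //= eqxx mul1r big1 => [|k /negPf kj].
  by rewrite addr0 /star /= conjC_nat eq_sym.
by rewrite eq_sym kj mul0r.
Qed.
Lemma delta_unitaryr (j l : 'I_d) :
  \sum_(k < d) star ((k == j)%:R : C^o) * (k == l)%:R = (j == l)%:R :> C^o.
Proof.
rewrite (bigD1 j) //= eqxx big1 => [|k /negPf kj].
  by rewrite addr0 /star /= conjC_nat mul1r.
by rewrite kj /star /= conjC_nat mul0r.
Qed.
Lemma delta_selfadjoint (j k : 'I_d) :
  star ((j == k)%:R : C^o) = (j == k)%:R :> C^o.
Proof. exact: conjC_nat. Qed.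

Lemma o_plus_nontrivial : opi (tconst 1) != opi (tconst 0).
Proof.
apply/eqP => /opi_eq
  /(o_plus_eval_cong delta_selfadjoint delta_unitaryl delta_unitaryr) /= /eqP.
by rewrite scale1r scale0r oner_eq0.
Qed.

HB.instance Definition _ := GRing.isZmodule.Build pol_O_plus
  oaddA oaddC oadd0 oaddN.
HB.instance Definition _ := GRing.Zmodule_isNzRing.Build pol_O_plus
  omulA omul1l omul1r omulDl omulDr o_plus_nontrivial.
HB.instance Definition _ := GRing.Zmodule_isLmodule.Build C pol_O_plus
  oscaleA oscale1 oscaleDr oscaleDl.
HB.instance Definition _ := GRing.Lmodule_isLalgebra.Build C pol_O_plus oscaleAl.
HB.instance Definition _ := GRing.Lalgebra_isAlgebra.Build C pol_O_plus oscaleAr.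
HB.instance Definition _ := Algebra_isStarAlgebra.Build C pol_O_plus
  ostarD ostarZ ostarM ostarK.

Definition o_plus_gen (j k : 'I_d) : pol_O_plus := opi (u j k).

Lemma opi_sum (F : 'I_d -> term) :
  opi (\big[@tadd _ _/tconst 0]_(k < d) F k) = \sum_(k < d) opi (F k).
Proof. by elim/big_rec2: _ => [//|k x y _ <-]; rewrite -oaddE. Qed.

Lemma opi_const c : opi (tconst c) = c%:A.
Proof.
rewrite [RHS](_ : _ = oscale c (opi (tconst 1))) // oscaleE; apply/opi_eq.
by have := cong_constM o_plus_rel c 1; rewrite mulr1.
Qed.

Lemma o_plus_gen_selfadjoint j k : star (o_plus_gen j k) = o_plus_gen j k.
Proof.
rewrite [LHS](_ : _ = ostar (opi (u j k))) // ostarE; apply/opi_eq.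
exact/cong_rel/o_plus_selfadjoint.
Qed.

Lemma o_plus_gen_unitaryl j l :
  \sum_(k < d) o_plus_gen j k * star (o_plus_gen l k) = (j == l)%:R.
Proof.
have /cong_rel/opi_eq := o_plus_unitaryl j l.
rewrite opi_const scaler_nat opi_sum => <-.
by apply: eq_bigr => k _; rewrite -omulE -ostarE.
Qed.

Lemma o_plus_gen_unitaryr j l :
  \sum_(k < d) star (o_plus_gen k j) * o_plus_gen k l = (j == l)%:R.
Proof.
have /cong_rel/opi_eq := o_plus_unitaryr j l.
rewrite opi_const scaler_nat opi_sum => <-.
by apply: eq_bigr => k _; rewrite -omulE -ostarE.
Qed.

Section UniversalProperty.
Variables (B : starAlgType C) (v : 'I_d -> 'I_d -> B).
Hypothesis v_selfadjoint : forall j k, star (v j k) = v j k.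
Hypothesis v_unitaryl : forall j l,
  \sum_(k < d) v j k * star (v l k) = (j == l)%:R.
Hypothesis v_unitaryr : forall j l,
  \sum_(k < d) star (v k j) * v k l = (j == l)%:R.

Definition o_plus_lift_fun (x : pol_O_plus) : B :=
  star_eval (fun jk => v jk.1 jk.2) (repr x).

Lemma o_plus_lift_pi s :
  o_plus_lift_fun (opi s) = star_eval (fun jk => v jk.1 jk.2) s.
Proof. by apply: o_plus_eval_cong => //; exact: opi_repr. Qed.

Lemma o_plus_lift_additive : {morph o_plus_lift_fun : x y / x - y}.
Proof.
move=> x y; have [s ->] := opi_surj x; have [t ->] := opi_surj y.
rewrite [opi s - _](_ : _ = opi (tadd s (tmul (tconst (-1)) t))) /=; last first.
  by rewrite -oaddE -ooppE.
by rewrite !o_plus_lift_pi /= scaleN1r mulN1r.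
Qed.
Lemma o_plus_lift_scale : scalable o_plus_lift_fun.
Proof.
move=> c x; have [s ->] := opi_surj x.
rewrite [c *: _](_ : _ = opi (tmul (tconst c) s)); last by rewrite -oscaleE.
by rewrite !o_plus_lift_pi /= -scalerAl mul1r.
Qed.
Lemma o_plus_lift_monoid : monoid_morphism o_plus_lift_fun.
Proof.
split; first by rewrite [1](erefl : _ = opi (tconst 1)) o_plus_lift_pi /= scale1r.
move=> x y; have [s ->] := opi_surj x; have [t ->] := opi_surj y.
rewrite [opi s * _](_ : _ = opi (tmul s t)); last by rewrite -omulE.
by rewrite !o_plus_lift_pi.
Qed.
Lemma o_plus_lift_star x : o_plus_lift_fun (star x) = star (o_plus_lift_fun x).
Proof.
have [s ->] := opi_surj x.
rewrite [star (opi s)](_ : _ = opi (tstar s)); last by rewrite -ostarE.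
by rewrite !o_plus_lift_pi.
Qed.

HB.instance Definition _ := GRing.isZmodMorphism.Build pol_O_plus B
  o_plus_lift_fun o_plus_lift_additive.
HB.instance Definition _ := GRing.isScalable.Build C pol_O_plus B *:%R
  o_plus_lift_fun o_plus_lift_scale.
HB.instance Definition _ := GRing.isMonoidMorphism.Build pol_O_plus B
  o_plus_lift_fun o_plus_lift_monoid.

Definition o_plus_lift : star_morphism pol_O_plus B :=
  StarMorphism (star_morphism_fun := o_plus_lift_fun) o_plus_lift_star.

Lemma o_plus_lift_gen j k : o_plus_lift (o_plus_gen j k) = v j k.
Proof. exact: o_plus_lift_pi. Qed.

Lemma o_plus_lift_unique (f : star_morphism pol_O_plus B) :
  (forall j k, f (o_plus_gen j k) = v j k) -> f =1 o_plus_lift.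
Proof.
move=> fv x; have [s ->] := opi_surj x.
have gD (g : star_morphism pol_O_plus B) y z : g (y + z) = g y + g z.
  exact: rmorphD.
have gM (g : star_morphism pol_O_plus B) y z : g (y * z) = g y * g z.
  exact: rmorphM.
elim: s => [[j k]|c|s IHs t IHt|s IHs t IHt|s IHs].
- by rewrite -/(o_plus_gen j k) fv o_plus_lift_gen.
- by rewrite opi_const !linearZ /= !rmorph1.
- by rewrite -oaddE [oadd _ _](_ : _ = opi s + opi t) // !gD IHs IHt.
- by rewrite -omulE [omul _ _](_ : _ = opi s * opi t) // !gM IHs IHt.
- by rewrite -ostarE [ostar _](_ : _ = star (opi s)) // !star_morphism_star IHs.
Qed.

End UniversalProperty.

Definition o_plus_counit : character pol_O_plus :=
  o_plus_lift delta_selfadjoint delta_unitaryl delta_unitaryr.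

End FreeOrthogonal.

(* Main.v *)
(* A Schürmann triple (rho, eta, psi) on Pol(O_d^+) forces the Gram matrix
   G_jl = sum_k <eta(u_jk), eta(u_lk)> to be symmetric. On H = C^2 take
   rho = eps (+) chi, where chi(u) = -I. A cocycle for rho is then a pair of
   matrices eta(u) = (X, Y) with X antisymmetric (Gaussian part) and Y symmetric,
   and G is the sum of the Gram matrices of X and Y. With X_13 = 1, X_23 = i,
   Y_11 = 1 and Y_12 = -i (the other entries being 0 or given by symmetry), the
   Gram matrices of X and of Y are not symmetric, with opposite imaginary parts:
   neither eta_G nor eta_N can be completed, but their sum can, by
   psi(u) = - G / 2. *)

From HB Require Import structures.
Require Import Defs.
From mathcomp Require Import all_boot all_order all_algebra.
From mathcomp Require Import all_classical all_reals all_analysis.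
From mathcomp Require Import complex ring.

Set Implicit Arguments.
Unset Strict Implicit.
Unset Printing Implicit Defensive.

Import Order.TTheory GRing.Theory Num.Theory.
Import numFieldNormedType.Exports.

Local Open Scope classical_set_scope.
Local Open Scope ring_scope.

(** * The space C^n with its Euclidean norm *)

(** An alias of column vectors: plain matrices already carry the sup norm, so the norm of the inner
    product is put on a separate type. *)
Definition euclidean (C : numClosedFieldType) (n : nat) := 'cV[C]_n.

Section EuclideanNorm.
Variables (C : numClosedFieldType) (n : nat).
Local Notation H := (euclidean C n).
Implicit Types (x y z : H) (c : C).

HB.instance Definition _ := GRing.Lmodule.on H.

Definition einner x y : C := \sum_i (x i 0)^* * y i 0.

Lemma einnerDr x y z : einner x (y + z) = einner x y + einner x z.
Proof. by rewrite -big_split; apply: eq_bigr => i _; rewrite mxE mulrDr. Qed.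

Lemma einnerZr c x y : einner x (c *: y) = c * einner x y.
Proof. by rewrite mulr_sumr; apply: eq_bigr => i _; rewrite mxE mulrCA. Qed.

Lemma einner_conj x y : einner y x = (einner x y)^*.
Proof.
by rewrite rmorph_sum; apply: eq_bigr => i _; rewrite rmorphM /= conjCK mulrC.
Qed.

(** The triangle inequality and definiteness come from the form [dotmx] on row vectors, which is
    linear in its first argument; hence the transposes and the swap. *)
Lemma einner_dotmx x y : einner x y = dotmx y^T x^T.
Proof.
by rewrite dotmxE mxE; apply: eq_bigr => i _; rewrite !mxE mulrC.
Qed.

Definition enorm x : C := sqrtC (einner x x).

Lemma enormD x y : enorm (x + y) <= enorm x + enorm y.
Proof.
by rewrite /enorm !einner_dotmx linearD; exact: (triangle_lerif (@dotmx C n)).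
Qed.

Lemma einner_norm x : einner x x = enorm x ^+ 2.
Proof. by rewrite sqrtCK. Qed.

Lemma enormZ c x : enorm (c *: x) = `|c| * enorm x.
Proof.
rewrite /enorm einnerZr einner_conj einnerZr rmorphM /= -einner_conj mulrA.
by rewrite -normCK rootCMl ?exprn_ge0// sqrCK.
Qed.

Lemma enorm_eq0 x : enorm x = 0 -> x = 0.
Proof.
move=> /eqP; rewrite sqrtC_eq0 einner_dotmx (dnorm_eq0 (@dotmx C n)).
by move=> /eqP xT0; rewrite -[x]trmxK xT0 trmx0.
Qed.

HB.instance Definition _ :=
  @Lmodule_isNormed.Build C H enorm enormD enormZ enorm_eq0.

Lemma enormE x : `|x| = enorm x. Proof. by []. Qed.

(** This bound and [enorm_le_sum] compare the norm with the moduli of the coordinates, so that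
    convergence and boundedness of matrices can be checked coordinatewise. *)
Lemma ler_coord_enorm x i : `|x i 0| <= `|x|.
Proof.
rewrite -(@ler_pXn2r _ 2) ?nnegrE // enormE -einner_norm normCKC.
rewrite /einner (bigD1 i) //= lerDl sumr_ge0 // => j _.
by rewrite -normCKC exprn_ge0.
Qed.

Lemma enorm_le_sum x : `|x| <= \sum_i `|x i 0|.
Proof.
rewrite -(@ler_pXn2r _ 2) ?nnegrE ?sumr_ge0 // enormE -einner_norm expr2 mulr_suml.
apply: ler_sum => i _; rewrite -normCKC expr2 ler_wpM2l //.
by rewrite (bigD1 i) //= lerDl sumr_ge0.
Qed.

End EuclideanNorm.

(** * Completeness of C^n *)

Section EuclideanHilbert.
Variables (R : realType) (n : nat).
Local Notation C := (complex R).
Local Notation H := (euclidean C n).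

Lemma normc_ge_Im (z : C) : `|complex.Im z|%:C%C <= `|z|.
Proof.
by rewrite normc_def lecR -sqrtr_sqr ler_wsqrtr // lerDr sqr_ge0.
Qed.

Lemma normc_le_ReIm (z : C) :
  `|z| <= `|complex.Re z|%:C%C + `|complex.Im z|%:C%C.
Proof.
rewrite {1}[z]complexE (le_trans (ler_normD _ _)) // normrM.
by rewrite !normc_def /= !expr0n !expr1n /= !(addr0, add0r) sqrtr1 mul1r !sqrtr_sqr.
Qed.

(** The real and imaginary parts of each coordinate are 1-Lipschitz, so they send [F] to Cauchy
    filters on [R]; their limits assemble into the limit of [F]. *)
Lemma euclidean_complete (F : set_system H) :
  ProperFilter F -> cauchy F -> cvg F.
Proof.
move=> FF Fc.
have coord_cvg (f : H -> R) :
    (forall x y : H, `|f x - f y|%:C%C <= `|x - y|) -> cvg (f @ F).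
  move=> f_le; apply: cauchy_cvg; apply/cauchyP => e e0.
  have eC0 : 0 < e%:C%C by rewrite -(rmorph0 (real_complex R)) ltcR.
  have /cauchyP /(_ _ eC0) [y Fy] := Fc.
  exists (f y); rewrite /fmap /= /nbhs /=; apply: filterS Fy => z.
  rewrite -!ball_normE /ball_ /= => yz.
  by rewrite -ltcR; exact: le_lt_trans yz.
have re_cvg i : cvg ((fun x : H => complex.Re (x i 0)) @ F).
  apply: coord_cvg => x y; apply: (le_trans _ (ler_coord_enorm (x - y) i)).
  by rewrite !mxE -raddfB; exact: normc_ge_Re.
have im_cvg i : cvg ((fun x : H => complex.Im (x i 0)) @ F).
  apply: coord_cvg => x y; apply: (le_trans _ (ler_coord_enorm (x - y) i)).
  by rewrite !mxE -raddfB; exact: normc_ge_Im.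
pose y : H := \col_i (lim ((fun x : H => complex.Re (x i 0)) @ F) +i*
  lim ((fun x : H => complex.Im (x i 0)) @ F))%C.
apply/cvg_ex; exists y; apply/cvgrPdist_lt => e.
case: e => e e' /=; rewrite ltcE /= => /andP[/eqP -> e0].
(* Each of the [n] coordinates contributes two such errors; dividing by [n.+1] keeps the total
   strictly below [e] and covers [n = 0]. *)
have e1 : 0 < e / (2 * n.+1%:R) by rewrite divr_gt0 // mulr_gt0.
have near_re i : F [set x : H |
    `|complex.Re (y i 0) - complex.Re (x i 0)| < e / (2 * n.+1%:R)].
  by rewrite mxE /=; move/cvgrPdist_lt: (re_cvg i); apply.
have near_im i : F [set x : H |
    `|complex.Im (y i 0) - complex.Im (x i 0)| < e / (2 * n.+1%:R)].
  by rewrite mxE /=; move/cvgrPdist_lt: (im_cvg i); apply.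
have near_all :=
  @filterI _ F FF _ _ (filter_forall FF near_re) (filter_forall FF near_im).
apply: (@filterS _ F FF _ _ _ near_all) => x [re_lt im_lt].
apply: le_lt_trans (enorm_le_sum (y - x)) _.
apply: (@le_lt_trans _ _ (\sum_(i < n) (e / n.+1%:R)%:C%C)).
  apply: ler_sum => i _; rewrite (le_trans (normc_le_ReIm _)) // -rmorphD lecR.
  rewrite mxE [(- x) i 0]mxE !raddfB /= (splitr (e / _)).
  rewrite -[_ / 2]mulrA -invfM [_ * 2]mulrC.
  by apply: lerD; apply: ltW; [exact: re_lt | exact: im_lt].
rewrite -rmorph_sum ltcR sumr_const card_ord -[_ *+ n]mulr_natr mulrAC.
by rewrite ltr_pdivrMr // ltr_pM2l // ltr_nat.
Qed.

HB.instance Definition _ := Uniform_isComplete.Build H euclidean_complete.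

HB.instance Definition _ := @CompleteNormedModule_isHilbert.Build C H
  (@einner C n) (@einnerDr C n) (@einnerZr C n)
  (@einner_conj C n) (@einner_norm C n).

End EuclideanHilbert.

(** * Conjugate transposes of complex matrices *)

Section AdjointMatrix.
Variable C : numClosedFieldType.

Definition adjmx m n (M : 'M[C]_(m, n)) : 'M[C]_(n, m) := map_mx Num.conj M^T.

Lemma adjmxD m n (M N : 'M[C]_(m, n)) : adjmx (M + N) = adjmx M + adjmx N.
Proof. by rewrite /adjmx linearD map_mxD. Qed.

Lemma adjmxN m n (M : 'M[C]_(m, n)) : adjmx (- M) = - adjmx M.
Proof. by rewrite /adjmx linearN map_mxN. Qed.

Lemma adjmxZ m n c (M : 'M[C]_(m, n)) : adjmx (c *: M) = c^* *: adjmx M.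
Proof. by rewrite /adjmx linearZ /= map_mxZ. Qed.

Lemma adjmxM m n p (M : 'M[C]_(m, n)) (N : 'M[C]_(n, p)) :
  adjmx (M *m N) = adjmx N *m adjmx M.
Proof. by rewrite /adjmx trmx_mul map_mxM. Qed.

Lemma adjmxK m n (M : 'M[C]_(m, n)) : adjmx (adjmx M) = M.
Proof. by apply/matrixP => i j; rewrite !mxE conjCK. Qed.

Lemma adjmx_sum m n I (r : seq I) (P : pred I) (F : I -> 'M[C]_(m, n)) :
  adjmx (\sum_(i <- r | P i) F i) = \sum_(i <- r | P i) adjmx (F i).
Proof. by rewrite /adjmx linear_sum /= map_mx_sum. Qed.

End AdjointMatrix.

(* The tuple (e, r, x, z, p) stands for the block matrix
     [[e, z, p], [0, r, x], [0, 0, e]];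
   a Schürmann triple on C^n is a *-homomorphism into these matrices, the
   involution being the adjoint for the form that exchanges the outer blocks. *)
Definition triple_alg (C : numClosedFieldType) (n : nat) : Type :=
  (C^o * 'M[C]_n * 'cV[C]_n * 'rV[C]_n * 'M[C]_1)%type.

(** * The *-algebra of block matrices *)

Section TripleAlgebra.
Variables (C : numClosedFieldType) (n : nat).
Local Notation T := (triple_alg C n).
Implicit Types a b c : T.

HB.instance Definition _ := GRing.Lmodule.on T.

Definition tri_eps a : C := a.1.1.1.1.
Definition tri_rep a : 'M[C]_n := a.1.1.1.2.
Definition tri_col a : 'cV[C]_n := a.1.1.2.
Definition tri_row a : 'rV[C]_n := a.1.2.
Definition tri_fun a : 'M[C]_1 := a.2.

Definition tri_mul a b : T :=
  (tri_eps a * tri_eps b : C^o, tri_rep a *m tri_rep b,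
   tri_rep a *m tri_col b + tri_eps b *: tri_col a,
   tri_eps a *: tri_row b + tri_row a *m tri_rep b,
   tri_eps a *: tri_fun b + tri_eps b *: tri_fun a + tri_row a *m tri_col b).
Definition tri_one : T := (1 : C^o, 1%:M, 0, 0, 0).
Definition tri_star a : T :=
  ((tri_eps a)%R^* : C^o, adjmx (tri_rep a)%R, adjmx (tri_row a)%R,
   adjmx (tri_col a)%R, adjmx (tri_fun a)%R).

Lemma tri_ext a b :
  tri_eps a = tri_eps b -> tri_rep a = tri_rep b -> tri_col a = tri_col b ->
  tri_row a = tri_row b -> tri_fun a = tri_fun b -> a = b.
Proof.
case: a => [[[[ea ra] xa] za] pa]; case: b => [[[[eb rb] xb] zb] pb].
rewrite /tri_eps /tri_rep /tri_col /tri_row /tri_fun.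
by rewrite /= => -> -> -> -> ->.
Qed.

Lemma tri_addE a b :
  ((tri_eps (a + b) = tri_eps a + tri_eps b)%R *
   (tri_rep (a + b) = tri_rep a + tri_rep b)%R *
   (tri_col (a + b) = tri_col a + tri_col b)%R *
   (tri_row (a + b) = tri_row a + tri_row b)%R *
   (tri_fun (a + b) = tri_fun a + tri_fun b)%R)%type.
Proof. by []. Qed.

Lemma tri_scaleE k a :
  ((tri_eps (k *: a) = k * tri_eps a)%R *
   (tri_rep (k *: a) = k *: tri_rep a)%R *
   (tri_col (k *: a) = k *: tri_col a)%R *
   (tri_row (k *: a) = k *: tri_row a)%R *
   (tri_fun (k *: a) = k *: tri_fun a)%R)%type.
Proof. by []. Qed.

(** These rules concern the raw operations, with which the axioms are proved; [tri_mulE], [tri_oneE]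
    and [tri_starE] restate them for the resulting *-algebra. *)
Lemma tri_mulE_subproof a b :
  ((tri_eps (tri_mul a b) = tri_eps a * tri_eps b)%R *
   (tri_rep (tri_mul a b) = tri_rep a *m tri_rep b)%R *
   (tri_col (tri_mul a b) =
     tri_rep a *m tri_col b + tri_eps b *: tri_col a)%R *
   (tri_row (tri_mul a b) =
     tri_eps a *: tri_row b + tri_row a *m tri_rep b)%R *
   (tri_fun (tri_mul a b) = tri_eps a *: tri_fun b + tri_eps b *: tri_fun a +
     tri_row a *m tri_col b)%R)%type.
Proof. by []. Qed.

Lemma tri_oneE_subproof :
  ((tri_eps tri_one = 1)%R * (tri_rep tri_one = 1%:M)%R * (tri_col tri_one = 0)%R *
   (tri_row tri_one = 0)%R * (tri_fun tri_one = 0)%R)%type.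
Proof. by []. Qed.

Lemma tri_starE_subproof a :
  ((tri_eps (tri_star a) = (tri_eps a)^*)%R *
   (tri_rep (tri_star a) = adjmx (tri_rep a))%R *
   (tri_col (tri_star a) = adjmx (tri_row a))%R *
   (tri_row (tri_star a) = adjmx (tri_col a))%R *
   (tri_fun (tri_star a) = adjmx (tri_fun a))%R)%type.
Proof. by []. Qed.

Let triE := (tri_mulE_subproof, tri_oneE_subproof, tri_starE_subproof,
  tri_addE, tri_scaleE).

Lemma tri_mulA : associative tri_mul.
Proof.
move=> a b c; apply: tri_ext; rewrite !triE.
- exact: mulrA.
- exact: mulmxA.
- by rewrite mulmxDr mulmxA -scalemxAr scalerDr scalerA addrA [_ c * _]mulrC.
- by rewrite mulmxDl mulmxA -scalemxAl scalerDr scalerA addrA.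
- rewrite mulmxDl mulmxDr !scalerDr !scalerA -!scalemxAl -!scalemxAr mulmxA.
  rewrite [tri_eps c * tri_eps a]mulrC [tri_eps c * tri_eps b]mulrC -!addrA.
  by congr (_ + (_ + _)); rewrite addrCA; congr (_ + _); rewrite addrA addrC.
Qed.

Lemma tri_mul1l : left_id tri_one tri_mul.
Proof.
move=> a; apply: tri_ext; rewrite !triE ?scale1r ?scaler0 ?mul0mx ?addr0 //.
- exact: mul1r.
- exact: mul1mx.
- exact: mul1mx.
Qed.

Lemma tri_mul1r : right_id tri_one tri_mul.
Proof.
move=> a; apply: tri_ext;
  rewrite !triE ?scale1r ?scaler0 ?mulmx0 ?addr0 ?add0r //.
- exact: mulr1.
- exact: mulmx1.
- exact: mulmx1.
Qed.

Lemma tri_mulDl : left_distributive tri_mul +%R.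
Proof.
move=> a b c; apply: tri_ext; rewrite !triE.
- exact: mulrDl.
- exact: mulmxDl.
- by rewrite mulmxDl scalerDr addrACA.
- by rewrite mulmxDl scalerDl addrACA.
- by rewrite mulmxDl scalerDr scalerDl [RHS]addrACA
  (addrACA (_ *: _) (_ *: _) (_ *: _)).
Qed.

Lemma tri_mulDr : right_distributive tri_mul +%R.
Proof.
move=> a b c; apply: tri_ext; rewrite !triE.
- exact: mulrDr.
- exact: mulmxDr.
- by rewrite mulmxDr scalerDl addrACA.
- by rewrite mulmxDr scalerDr addrACA.
- by rewrite mulmxDr scalerDr scalerDl [RHS]addrACA
  (addrACA (_ *: _) (_ *: _) (_ *: _)).
Qed.

Lemma tri_one_neq0 : tri_one != 0.
Proof. by apply/eqP => -[/eqP]; rewrite oner_eq0. Qed.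

HB.instance Definition _ := GRing.Zmodule_isNzRing.Build T
  tri_mulA tri_mul1l tri_mul1r tri_mulDl tri_mulDr tri_one_neq0.

Lemma tri_scaleAl (k : C) a b : k *: tri_mul a b = tri_mul (k *: a) b.
Proof.
apply: tri_ext; rewrite !triE; first exact: mulrA.
- exact: scalemxAl.
- by rewrite scalerDr -scalemxAl !scalerA [k * _]mulrC.
- by rewrite scalerDr -scalemxAl !scalerA.
- by rewrite !scalerDr -scalemxAl !scalerA [k * tri_eps b]mulrC.
Qed.

Lemma tri_scaleAr (k : C) a b : k *: tri_mul a b = tri_mul a (k *: b).
Proof.
apply: tri_ext; rewrite !triE; first exact: mulrCA.
- exact: scalemxAr.
- by rewrite scalerDr -scalemxAr !scalerA.
- by rewrite scalerDr -scalemxAr !scalerA [k * _]mulrC.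
- by rewrite !scalerDr -scalemxAr !scalerA [k * tri_eps a]mulrC.
Qed.

HB.instance Definition _ := GRing.Lmodule_isLalgebra.Build C T tri_scaleAl.
HB.instance Definition _ := GRing.Lalgebra_isAlgebra.Build C T tri_scaleAr.

Lemma tri_starD a b : tri_star (a + b) = tri_star a + tri_star b.
Proof.
by apply: tri_ext; rewrite !triE; [exact: rmorphD|..]; exact: adjmxD.
Qed.

Lemma tri_starZ (k : C) a : tri_star (k *: a) = k^* *: tri_star a.
Proof.
by apply: tri_ext; rewrite !triE; [exact: rmorphM|..]; exact: adjmxZ.
Qed.

Lemma tri_starM a b : tri_star (tri_mul a b) = tri_mul (tri_star b) (tri_star a).
Proof.
apply: tri_ext; rewrite !triE ?(adjmxD, adjmxZ, adjmxM) //.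
- by rewrite rmorphM mulrC.
- by rewrite addrC.
- by rewrite addrC.
- by rewrite [X in X + _]addrC.
Qed.

Lemma tri_starK a : tri_star (tri_star a) = a.
Proof. by apply: tri_ext; rewrite !triE; [exact: conjCK|..]; exact: adjmxK. Qed.

HB.instance Definition _ := Algebra_isStarAlgebra.Build C T
  tri_starD tri_starZ tri_starM tri_starK.

Lemma tri_mulE a b :
  ((tri_eps (a * b) = tri_eps a * tri_eps b)%R *
   (tri_rep (a * b) = tri_rep a *m tri_rep b)%R *
   (tri_col (a * b) = tri_rep a *m tri_col b + tri_eps b *: tri_col a)%R *
   (tri_row (a * b) = tri_eps a *: tri_row b + tri_row a *m tri_rep b)%R *
   (tri_fun (a * b) = tri_eps a *: tri_fun b + tri_eps b *: tri_fun a +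
     tri_row a *m tri_col b)%R)%type.
Proof. exact: tri_mulE_subproof. Qed.

Lemma tri_oneE :
  ((tri_eps (1 : T) = 1)%R * (tri_rep (1 : T) = 1%:M)%R * (tri_col (1 : T) = 0)%R *
   (tri_row (1 : T) = 0)%R * (tri_fun (1 : T) = 0)%R)%type.
Proof. exact: tri_oneE_subproof. Qed.

Lemma tri_starE a :
  ((tri_eps (star a) = (tri_eps a)^*)%R *
   (tri_rep (star a) = adjmx (tri_rep a))%R *
   (tri_col (star a) = adjmx (tri_row a))%R *
   (tri_row (star a) = adjmx (tri_col a))%R *
   (tri_fun (star a) = adjmx (tri_fun a))%R)%type.
Proof. exact: tri_starE_subproof. Qed.

End TripleAlgebra.

(** * Linearity and equivariance of orthogonal projections *)

Section OrthogonalProjection.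
Variables (R : realType) (H : hilbertType (complex R)) (K : closed_subspace H).

Lemma orthoproj_linear : linear (@orthoproj R H K).
Proof.
move=> c x y; apply: orthoproj_unique.
  by apply: subspaceZD; exact: orthoproj_in.
rewrite opprD addrACA -scalerBr.
by apply: subspaceZD; exact: orthoproj_ortho.
Qed.

(** [K] and its orthogonal complement are both invariant, so [rho a] maps the decomposition of [x]
    to that of [rho a x]. *)
Lemma orthoproj_rep (A : starAlgType (complex R)) (rho : representation A H) :
  (forall a x, subspace_set K x -> subspace_set K (rho a x)) ->
  forall a x, orthoproj K (rho a x) = rho a (orthoproj K x).
Proof.
move=> invK a x; apply: orthoproj_unique; first exact/invK/orthoproj_in.
by rewrite -linearB; apply: ortho_invariant => //; exact: orthoproj_ortho.
Qed.

End OrthogonalProjection.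

(** * The two parts of a cocycle meet the hypotheses of (GC) and (NC) *)

Section GaussianSplitting.
Variables (R : realType) (A : starAlgType (complex R)) (eps : character A).
Variables (H : hilbertType (complex R)) (rho : representation A H) (eta : A -> H).
Hypothesis eta_cocycle : is_cocycle eps rho eta.

Let HG := gaussian_part eps rho.

Lemma orthoproj_gaussian a x :
  orthoproj HG (rho a x) = (eps a : complex R) *: orthoproj HG x.
Proof.
rewrite orthoproj_rep; last exact: gaussian_part_invariant.
exact: (orthoproj_in HG x).
Qed.

(** Projecting the cocycle identity onto H_G turns [rho a] into [eps a]. The representation is
    [character_rep], as [property_GC] demands; [rho_G] acts in the same way. *)
Lemma eta_G_cocycle : is_cocycle eps (character_rep eps _) (eta_G eps rho eta).
Proof.
have [eta_lin etaM] := eta_cocycle; split=> [c a b|a b]; apply: val_inj => /=.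
  by rewrite eta_lin orthoproj_linear.
by rewrite etaM addrC orthoproj_linear orthoproj_gaussian addrC.
Qed.

Lemma eta_N_cocycle : is_cocycle eps (rho_N eps rho) (eta_N eps rho eta).
Proof.
have [eta_lin etaM] := eta_cocycle; split=> [c a b|a b]; apply: val_inj => /=.
  by rewrite eta_lin orthoproj_linear scalerBr opprD addrACA.
rewrite etaM [rho a _ + _]addrC orthoproj_linear opprD addrACA addrC -scalerBr.
congr (_ + _).
rewrite linearB orthoproj_rep //; exact: gaussian_part_invariant.
Qed.

(** A vector on which [rho_N] acts by [eps] lies in H_G and in its orthogonal complement, hence is
    0. *)
Lemma gaussian_set_rho_N : gaussian_set eps (rho_N eps rho) = [set 0].
Proof.
apply/seteqP; split=> [x Gx|_ ->]; last exact: (@gaussian_set0 _ _ eps).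
apply: val_inj; apply: (@subspace_ortho_disj R H HG).
  by move=> a; have := congr1 val (Gx a).
exact/in_subspaceP/subspace_valP.
Qed.

End GaussianSplitting.

(** * The Gram matrix obstruction on Pol(O_d^+) *)

Section FreeOrthogonalTriples.
Variables (C : numClosedFieldType) (d : nat).
Local Notation A := (pol_O_plus C d).
Local Notation eps := (o_plus_counit C d).
Local Notation u := (@o_plus_gen C d).

(** Every element is the class of a term, so induction on terms descends to the quotient. *)
Lemma o_plus_ind (P : A -> Prop) :
  (forall j k, P (u j k)) -> (forall c : C, P c%:A) ->
  (forall a b, P a -> P b -> P (a + b)) ->
  (forall a b, P a -> P b -> P (a * b)) ->
  (forall a, P a -> P (star a)) -> forall a, P a.
Proof.
move=> Pgen Pconst Padd Pmul Pstar a; have [s ->] := opi_surj a.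
elim: s => [[j k]|c|s IHs t IHt|s IHs t IHt|s IHs].
- exact: Pgen.
- by rewrite opi_const.
- by rewrite -oaddE; exact: Padd.
- by rewrite -omulE; exact: Pmul.
- by rewrite -ostarE; exact: Pstar.
Qed.

Lemma o_plus_counit_gen j k : eps (u j k) = (j == k)%:R.
Proof. exact: o_plus_lift_gen. Qed.

(* Evaluating psi on the relation [u u^T = 1] gives
   psi(u_jl) + psi(u_lj) + Gram_jl = psi(delta_jl), where only the Gram
   matrix could fail to be symmetric. *)
Lemma schurmann_gram_sym (H : hilbertType C) (rho : representation A H)
    (eta : A -> H) (psi : A -> C) :
  is_schurmann_triple eps rho eta psi -> forall j l,
  \sum_k inner (eta (u j k)) (eta (u l k)) =
  \sum_k inner (eta (u l k)) (eta (u j k)).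
Proof.
case=> _ psi_lin psiM.
have psiE j l : psi (j == l)%:R =
    psi (u j l) + psi (u l j) + \sum_k inner (eta (u j k)) (eta (u l k)).
  pose f := GRing.isLinear.Build _ _ _ _ _ psi_lin.
  pose psi' : {linear A -> C} := HB.pack psi f.
  rewrite -o_plus_gen_unitaryl -[psi]/(psi' : A -> C) linear_sum /= /psi' /=.
  rewrite (eq_bigr (fun k => psi (u j k) * (l == k)%:R + (j == k)%:R * psi (u l k)
    + inner (eta (u j k)) (eta (u l k)))); last first.
    by move=> k _; rewrite psiM !o_plus_gen_selfadjoint !o_plus_counit_gen.
  rewrite !big_split /=; congr (_ + _ + _).
    rewrite (bigD1 l) //= eqxx mulr1 big1 ?addr0 // => k /negPf kl.
    by rewrite eq_sym kl mulr0.
  rewrite (bigD1 j) //= eqxx mul1r big1 ?addr0 // => k /negPf kj.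
  by rewrite eq_sym kj mul0r.
move=> j l; apply: (addrI (psi (u j l) + psi (u l j))).
by rewrite -psiE eq_sym psiE [psi (u l j) + _]addrC.
Qed.

End FreeOrthogonalTriples.

(** * From *-homomorphisms into block matrices to Schürmann triples *)

Section TripleOfMorphism.
Variables (R : realType) (n : nat).
Local Notation C := (complex R).
Local Notation H := (euclidean C n).

Lemma inner_adjmx (x y : H) : inner x y = (adjmx x *m y) 0 0.
Proof. by rewrite mxE; apply: eq_bigr => i _; rewrite !mxE. Qed.

Lemma mulmx_enorm_bounded (M : 'M[C]_n) :
  exists c : C, forall x : H, `|M *m x : H| <= c * `|x|.
Proof.
exists (\sum_i \sum_j `|M i j|) => x; rewrite mulr_suml.
apply: le_trans (enorm_le_sum _) _; apply: ler_sum => i _.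
rewrite mxE mulr_suml; apply: le_trans (ler_norm_sum _ _ _) _.
by apply: ler_sum => j _; rewrite normrM ler_wpM2l // ler_coord_enorm.
Qed.

Variables (A : starAlgType C) (eps : character A).
Variable f : star_morphism A (triple_alg C n).
Hypothesis f_eps : forall a, tri_eps (f a) = eps a.

Definition tri_op (a : A) (x : H) : H := tri_rep (f a) *m x.

Lemma tri_op_linear a : linear (tri_op a).
Proof. by move=> c x y; rewrite /tri_op mulmxDr scalemxAr. Qed.

Lemma tri_op_bounded a : exists c : C, forall x, `|tri_op a x| <= c * `|x|.
Proof. exact: mulmx_enorm_bounded. Qed.

Lemma tri_linear x : linear (tri_op^~ x).
Proof.
by move=> c a b; rewrite /tri_op linearP tri_addE tri_scaleE mulmxDl scalemxAl.
Qed.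

Lemma tri_op1 x : tri_op 1 x = x.
Proof. by rewrite /tri_op rmorph1 tri_oneE mul1mx. Qed.

Lemma tri_opM a b x : tri_op (a * b) x = tri_op a (tri_op b x).
Proof. by rewrite /tri_op rmorphM tri_mulE mulmxA. Qed.

Lemma tri_op_star a x y : inner (tri_op (star a) x) y = inner x (tri_op a y).
Proof.
by rewrite !inner_adjmx /tri_op star_morphism_star tri_starE adjmxM adjmxK mulmxA.
Qed.

Definition tri_representation : representation A H :=
  Representation tri_op_linear tri_op_bounded tri_linear tri_op1 tri_opM
    tri_op_star.

Definition tri_cocycle (a : A) : H := tri_col (f a).
Definition tri_functional (a : A) : C := tri_fun (f a) 0 0.

(** In [f (a * b) = f a * f b], the column block is the cocycle identity and the corner block is the
    identity for psi; since [f] respects [star], the row block of [f a] is the adjoint of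
    [eta (star a)], whence the inner product. *)
Lemma tri_schurmann_triple :
  is_schurmann_triple eps tri_representation tri_cocycle tri_functional.
Proof.
split; first split.
- by move=> c a b; rewrite /tri_cocycle linearP tri_addE tri_scaleE.
- by move=> a b; rewrite /tri_cocycle rmorphM tri_mulE f_eps.
- by move=> c a b; rewrite /tri_functional linearP tri_addE tri_scaleE !mxE.
- move=> a b; rewrite /tri_functional inner_adjmx /tri_cocycle star_morphism_star.
  rewrite tri_starE adjmxK rmorphM tri_mulE !f_eps !mxE.
  by rewrite [_ * (eps b : C)]mulrC [(eps b : C) * _ + _]addrC.
Qed.

(** On the kernel of [eps], the triple identity reduces [psi (star a * a)] to the squared norm of
    [eta a]. *)
Lemma tri_generating_functional : generating_functional eps tri_functional.
Proof.
have [_ psi_lin psiM] := tri_schurmann_triple.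
split=> // [|a|a ea].
- by rewrite /tri_functional rmorph1 tri_oneE mxE.
- by rewrite /tri_functional star_morphism_star tri_starE !mxE.
- rewrite psiM starK inner_norm ea mulr0 star_morphism_star ea.
  by rewrite [star _](conjC0 C) mul0r !add0r exprn_ge0.
Qed.

End TripleOfMorphism.

(** * Block matrices satisfying the relations of O_d^+ *)

Section TripleFromGenerators.
Variables (C : numClosedFieldType) (n d : nat).
Variable D : 'M[C]_n.
Hypothesis D_adj : adjmx D = D.
Hypothesis D_invol : D *m D = 1%:M.

Definition tri_gram (X : 'I_d -> 'I_d -> 'cV[C]_n) (j l : 'I_d) : 'M[C]_1 :=
  \sum_k adjmx (X j k) *m X l k.

(** Selfadjointness of the generators forces the row block. With G = [tri_gram X], the corner p = -
    G / 2 is the symmetric solution of p_jl + p_lj + G_jl = 0, which unitarity requires. *)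
Definition tri_gen (X : 'I_d -> 'I_d -> 'cV[C]_n) (j k : 'I_d) : triple_alg C n :=
  ((j == k)%:R : C^o, (j == k)%:R *: D, X j k, adjmx (X j k),
   - 2^-1 *: tri_gram X j k).

Lemma tri_genE X j k :
  ((tri_eps (tri_gen X j k) = (j == k)%:R)%R *
   (tri_rep (tri_gen X j k) = (j == k)%:R *: D)%R *
   (tri_col (tri_gen X j k) = X j k)%R *
   (tri_row (tri_gen X j k) = adjmx (X j k))%R *
   (tri_fun (tri_gen X j k) = - 2^-1 *: tri_gram X j k)%R)%type.
Proof. by []. Qed.

Lemma adjmx_tri_gram X j l : adjmx (tri_gram X j l) = tri_gram X l j.
Proof.
by rewrite adjmx_sum; apply: eq_bigr => k _; rewrite adjmxM adjmxK.
Qed.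

Lemma sum_delta (V : lmodType C) (F : 'I_d -> V) j :
  \sum_k (j == k)%:R *: F k = F j.
Proof.
rewrite (bigD1 j) //= eqxx scale1r big1 ?addr0 // => k /negPf kj.
by rewrite eq_sym kj scale0r.
Qed.

Lemma tri_sumE (F : 'I_d -> triple_alg C n) :
  ((tri_eps (\sum_k F k) = \sum_k tri_eps (F k))%R *
   (tri_rep (\sum_k F k) = \sum_k tri_rep (F k))%R *
   (tri_col (\sum_k F k) = \sum_k tri_col (F k))%R *
   (tri_row (\sum_k F k) = \sum_k tri_row (F k))%R *
   (tri_fun (\sum_k F k) = \sum_k tri_fun (F k))%R)%type.
Proof. by do !split; elim/big_rec2: _ => // k x y _ <-; rewrite tri_addE. Qed.

Lemma tri_boolE (b : bool) :
  ((tri_eps (b%:R : triple_alg C n) = b%:R)%R *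
   (tri_rep (b%:R : triple_alg C n) = b%:R *: 1%:M)%R *
   (tri_col (b%:R : triple_alg C n) = 0)%R *
   (tri_row (b%:R : triple_alg C n) = 0)%R *
   (tri_fun (b%:R : triple_alg C n) = 0)%R)%type.
Proof.
by case: b; rewrite ?tri_oneE ?scale1r ?scale0r; do !split.
Qed.

Section Relations.
Variable X : 'I_d -> 'I_d -> 'cV[C]_n.
Hypothesis X_tr : forall j k, X k j = - (D *m X j k).
Hypothesis gram_sym : forall j l, tri_gram X j l = tri_gram X l j.

(** The Gram matrix is Hermitian, so its symmetry makes its entries, and with them the corner block,
    real. *)
Lemma tri_gen_selfadjoint j k : star (tri_gen X j k) = tri_gen X j k.
Proof.
apply: tri_ext; rewrite tri_starE !tri_genE.
- exact: conjC_nat.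
- by rewrite adjmxZ conjC_nat D_adj.
- exact: adjmxK.
- by [].
- by rewrite adjmxZ rmorphN fmorphV rmorph_nat adjmx_tri_gram gram_sym.
Qed.

(** The column block of the sum is [D *m X l j + X j l], which vanishes by [X_tr]; in the corner,
    two halves of the symmetric Gram matrix cancel against a whole one. *)
Lemma tri_gen_unitaryl j l :
  \sum_k tri_gen X j k * star (tri_gen X l k) = (j == l)%:R.
Proof.
under eq_bigr do rewrite tri_gen_selfadjoint.
apply: tri_ext; rewrite tri_sumE tri_boolE;
  under eq_bigr do rewrite tri_mulE !tri_genE.
- by rewrite (sum_delta (fun k => (l == k)%:R : C^o)) eq_sym.
- under eq_bigr do rewrite -scalemxAl -scalemxAr D_invol.
  by rewrite sum_delta eq_sym.
- under eq_bigr do rewrite -scalemxAl.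
  by rewrite big_split /= !sum_delta (X_tr l j) subrr.
- under eq_bigr do rewrite -scalemxAr.
  rewrite big_split /= !sum_delta -{1}D_adj -adjmxM -adjmxD.
  by rewrite (X_tr j l) addNr /adjmx trmx0 map_mx0.
- rewrite !big_split /= !sum_delta (gram_sym l j) -scalerDl -/(tri_gram X j l).
  by rewrite -opprD -[2^-1]div1r -splitr scaleN1r addNr.
Qed.

End Relations.

(** Exchanging the indices of [X] reduces this to [tri_gen_unitaryl]: [D] is unitary and
    [X k j = - (D *m X j k)], so the transposed family has the same Gram matrix. *)
Lemma tri_gen_unitaryr X j l :
  (forall j k, X k j = - (D *m X j k)) ->
  (forall j l, tri_gram X j l = tri_gram X l j) ->
  \sum_k star (tri_gen X k j) * tri_gen X k l = (j == l)%:R.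
Proof.
move=> X_tr gram_sym; pose Y j k := X k j.
have gramE i m : tri_gram Y i m = tri_gram X i m.
  apply: eq_bigr => k _; rewrite /Y (X_tr i k) (X_tr m k).
  rewrite adjmxN mulNmx mulmxN opprK.
  by rewrite adjmxM D_adj mulmxA -(mulmxA _ D D) D_invol mulmx1.
have Y_gram i m : tri_gram Y i m = tri_gram Y m i by rewrite !gramE.
have Y_tr i k : Y k i = - (D *m Y i k) by exact: X_tr.
have genE i k : tri_gen X k i = tri_gen Y i k.
  by rewrite /tri_gen gramE gram_sym eq_sym.
rewrite -(tri_gen_unitaryl Y_tr Y_gram); apply: eq_bigr => k _.
by rewrite !genE !(tri_gen_selfadjoint Y_gram).
Qed.

End TripleFromGenerators.

(** * The triple given by an involution and a matrix of vectors *)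

Section FreeOrthogonalTripleFromGenerators.
Variables (R : realType) (n d : nat).
Local Notation C := (complex R).
Local Notation eps := (o_plus_counit C d).
Local Notation u := (@o_plus_gen C d).
Variables (D : 'M[C]_n) (X : 'I_d -> 'I_d -> 'cV[C]_n).
Hypothesis D_adj : adjmx D = D.
Hypothesis D_invol : D *m D = 1%:M.
Hypothesis X_tr : forall j k, X k j = - (D *m X j k).
Hypothesis gram_sym : forall j l, tri_gram X j l = tri_gram X l j.

Definition tri_morphism : star_morphism (pol_O_plus C d) (triple_alg C n) :=
  o_plus_lift (tri_gen_selfadjoint D_adj gram_sym)
    (tri_gen_unitaryl D_adj D_invol X_tr gram_sym)
    (fun j l => tri_gen_unitaryr D_adj D_invol j l X_tr gram_sym).

Lemma tri_morphism_gen j k : tri_morphism (u j k) = tri_gen D X j k.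
Proof. exact: o_plus_lift_gen. Qed.

Lemma tri_morphism_eps a : tri_eps (tri_morphism a) = eps a.
Proof.
elim/o_plus_ind: a => [j k|c|a b IHa IHb|a b IHa IHb|a IHa].
- by rewrite tri_morphism_gen tri_genE o_plus_counit_gen.
- by rewrite !linearZ !rmorph1 tri_scaleE tri_oneE.
- by rewrite !rmorphD tri_addE IHa IHb.
- by rewrite !rmorphM tri_mulE IHa IHb.
- by rewrite !star_morphism_star tri_starE IHa.
Qed.

Local Notation rho := (tri_representation tri_morphism).
Local Notation eta := (tri_cocycle tri_morphism).

Lemma tri_cocycle_gen j k : eta (u j k) = X j k.
Proof. by rewrite /tri_cocycle tri_morphism_gen. Qed.

Lemma tri_morphism_fixed (v : 'cV[C]_n) : D *m v = v ->
  forall a, tri_rep (tri_morphism a) *m v = (eps a : C) *: v.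
Proof.
move=> Dv a.
(* the adjoint statement makes the induction go through [star] *)
suff [] : tri_rep (tri_morphism a) *m v = (eps a : C) *: v /\
  adjmx v *m tri_rep (tri_morphism a) = (eps a : C) *: adjmx v by [].
have vD : adjmx v *m D = adjmx v by rewrite -{1}D_adj -adjmxM Dv.
elim/o_plus_ind: a =>
  [j k|c|a b [IHa IHa'] [IHb IHb']|a b [IHa IHa'] [IHb IHb']|a [IHa IHa']].
- rewrite tri_morphism_gen tri_genE o_plus_counit_gen.
  by rewrite -scalemxAl -scalemxAr Dv vD.
- rewrite !linearZ !rmorph1 tri_scaleE tri_oneE.
  by split; rewrite [X in _ = X *: _](mulr1 c) /= -?scalemxAl ?mul1mx ?mulmx1.
- by rewrite !rmorphD tri_addE mulmxDl mulmxDr IHa IHb IHa' IHb' !scalerDl.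
- rewrite !rmorphM tri_mulE -mulmxA IHb mulmxA IHa' -scalemxAl -scalemxAr.
  by rewrite IHa IHb' !scalerA [_ b * _]mulrC.
- rewrite !star_morphism_star tri_starE -{1}[v]adjmxK -!adjmxM IHa IHa'.
  by rewrite !adjmxZ adjmxK.
Qed.

(** At the generator [u j j] the representation is [D] and the counit is 1, so a Gaussian vector is
    fixed by [D]. The index [j] witnesses that a generator exists. *)
Lemma gaussian_set_tri (j : 'I_d) :
  gaussian_set eps rho = [set x : euclidean C n | D *m x = x].
Proof.
apply/seteqP; split=> [x Gx|x Dx a]; last exact: tri_morphism_fixed.
have := Gx (u j j); rewrite /= /tri_op tri_morphism_gen tri_genE.
by rewrite o_plus_counit_gen eqxx !scale1r.
Qed.

(** For a selfadjoint involution [D], (1 + D) / 2 is the spectral projection at the eigenvalue 1. *)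
Lemma orthoproj_tri (j : 'I_d) (x : euclidean C n) :
  orthoproj (gaussian_part eps rho) x = 2^-1 *: (x + D *m x).
Proof.
apply: orthoproj_unique.
  rewrite /= (gaussian_set_tri j) /= -scalemxAr mulmxDr mulmxA D_invol mul1mx.
  by rewrite addrC.
move=> y Gy; have {Gy} Dy : D *m y = y.
  have : gaussian_set eps rho y := Gy.
  by rewrite (gaussian_set_tri j).
rewrite innerBr innerZr innerDr !inner_adjmx mulmxA -{1}D_adj -adjmxM Dy.
by field.
Qed.

End FreeOrthogonalTripleFromGenerators.

(** * The explicit cocycle on C^2 *)

Section Counterexample.
Variables (R : realType) (m : nat).
Local Notation C := (complex R).
Local Notation d := m.+3.
Local Notation eps := (o_plus_counit C d).
Local Notation u := (@o_plus_gen C d).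

(** The matrix X of the overview, with indices from 0: X_13 and X_23 sit at (0, 2) and (1, 2).
    Natural number indices with default value 0 serve every [d] from 3 on; likewise for Y in
    [sym_coord]. *)
Definition anti_coord (j k : nat) : C :=
  match j, k with
  | 0%N, 2%N => 1 | 2%N, 0%N => - 1 | 1%N, 2%N => 'i | 2%N, 1%N => - 'i
  | _, _ => 0
  end.

Definition sym_coord (j k : nat) : C :=
  match j, k with
  | 0%N, 0%N => 1 | 0%N, 1%N | 1%N, 0%N => - 'i | _, _ => 0
  end.

Definition pair_col (a b : C) : euclidean C 2 :=
  \col_i (if i == 0 then a else b).

(** The value of eps (+) chi at each diagonal generator. *)
Definition flip_mx : 'M[C]_2 := diag_mx (\row_i (if i == 0 then 1 else - 1)).

Definition cx_col (j k : 'I_d) : euclidean C 2 :=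
  pair_col (anti_coord j k) (sym_coord j k).

Lemma pair_colP a b (x : euclidean C 2) :
  x 0 0 = a -> x 1 0 = b -> x = pair_col a b.
Proof.
move=> xa xb; apply/matrixP => i j; rewrite [j]ord1 !mxE.
by case: i => [[|[|i]] // i2] /=; rewrite -?xa -?xb; congr (x _ _); exact: val_inj.
Qed.

Lemma inner_pair_col a b a' b' :
  inner (pair_col a b) (pair_col a' b') = a^* * a' + b^* * b'.
Proof. by rewrite [LHS]big_ord_recl big_ord1 !mxE. Qed.

Lemma flip_pair_col a b : flip_mx *m pair_col a b = pair_col a (- b).
Proof.
by apply: pair_colP; rewrite mul_diag_mx !mxE /= ?mul1r // mulN1r.
Qed.

Lemma flip_mx_adj : adjmx flip_mx = flip_mx.
Proof.
rewrite /adjmx tr_diag_mx map_diag_mx; congr diag_mx.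
by apply/rowP => i; rewrite !mxE; case: ifP; rewrite ?rmorphN rmorph1.
Qed.

Lemma flip_mx_invol : flip_mx *m flip_mx = 1%:M.
Proof.
rewrite mulmx_diag -diag_const_mx; congr diag_mx.
by apply/rowP => i; rewrite !mxE; case: ifP; rewrite ?mulr1 // mulrNN mulr1.
Qed.

(** [flip_mx] fixes the first coordinate, which is antisymmetric in [j] and [k], and negates the
    second, which is symmetric. *)
Lemma cx_col_tr j k : cx_col k j = - (flip_mx *m cx_col j k).
Proof.
rewrite flip_pair_col; apply/esym/pair_colP; rewrite !mxE /= ?opprK.
  by case: j k => [[|[|[|j]]] jd] [[|[|[|k]]] kd] /=; rewrite ?opprK ?oppr0.
by case: j k => [[|[|[|j]]] jd] [[|[|[|k]]] kd].
Qed.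

Lemma sum_ord3 (F : nat -> C) : (forall k, F k.+3 = 0) ->
  \sum_(k < d) F k = F 0%N + F 1%N + F 2%N.
Proof.
move=> F3; rewrite 3!big_ord_recl big1 ?addr0 ?addrA // => k _.
exact: F3.
Qed.

Lemma anti_coord3 j k : anti_coord j k.+3 = 0.
Proof. by case: j => [|[|[|]]]. Qed.

Lemma sym_coord3 j k : sym_coord j k.+3 = 0.
Proof. by case: j => [|[|[|]]]. Qed.

(** Off the diagonal, the two Gram matrices are nonzero only at (0, 1) and (1, 0). At (0, 1) the
    antisymmetric part gives ['i] and the symmetric part [- 'i]; at (1, 0) the signs are reversed,
    so both entries of the sum vanish. *)
Lemma cx_gram_sym j l : tri_gram cx_col j l = tri_gram cx_col l j.
Proof.
pose g (j l : nat) := \sum_(k < d) ((anti_coord j k)^* * anti_coord l k +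
  (sym_coord j k)^* * sym_coord l k).
have gramE a b : tri_gram cx_col a b = (g a b)%:M.
  apply/matrixP => p q; rewrite [p]ord1 [q]ord1 summxE mxE eqxx mulr1n.
  by apply: eq_bigr => k _; rewrite -inner_adjmx inner_pair_col.
have gE a b : g a b = \sum_(k < 3) ((anti_coord a k)^* * anti_coord b k +
  (sym_coord a k)^* * sym_coord b k).
  rewrite /g (sum_ord3 (F := fun k => (anti_coord a k)^* * anti_coord b k +
    (sym_coord a k)^* * sym_coord b k)).
    by rewrite !big_ord_recr big_ord0 /= add0r.
  by move=> k; rewrite !anti_coord3 !sym_coord3 !mulr0 addr0.
rewrite !gramE; congr (_%:M); rewrite !gE !big_ord_recr !big_ord0 /=.
have conjCNi : (- 'i : C)^* = 'i by rewrite rmorphN /= conjCi opprK.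
have conjCN1 : (- 1 : C)^* = - 1 by rewrite rmorphN1.
(* Each index is 0, 1, 2 or at least 3, and in the last case all its coordinates are 0. *)
case: j l => [[|[|[|j]]] jd] [[|[|[|l]]] ld] //=;
  rewrite ?(conjCNi, conjCN1, conjCi, conjC1, conjC0); ring.
Qed.

Local Notation j0 := (@Ordinal d 0 isT).
Local Notation j1 := (@Ordinal d 1 isT).
Local Notation j2 := (@Ordinal d 2 isT).

Let f := tri_morphism flip_mx_adj flip_mx_invol cx_col_tr cx_gram_sym.
Let rho := tri_representation f.
Let eta := tri_cocycle f.

Let f_eps : forall a, tri_eps (f a) = eps a.
Proof. exact: tri_morphism_eps. Qed.

Let eta_gen j k : eta (u j k) = cx_col j k.
Proof. exact: tri_cocycle_gen. Qed.

Lemma cx_cocycle : is_cocycle eps rho eta.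
Proof. by have [] := tri_schurmann_triple f_eps. Qed.

Lemma cx_associated_triple : associated_triple eps rho eta (tri_functional f).
Proof.
split; first exact: tri_schurmann_triple.
have [eta_lin _] := cx_cocycle.
suff -> : range eta = setT by move=> O O0 _; rewrite setIT.
(* [eta (u j0 j2)] and [eta (u j0 j0)] are the two basis vectors of C^2, so [eta] is onto. *)
apply/seteqP; split=> // x _; exists (x 0 0 *: u j0 j2 + x 1 0 *: u j0 j0) => //.
rewrite eta_lin -[x 1 0 *: _]addr0 eta_lin.
have -> : eta 0 = 0.
  by have := eta_lin (-1) 0 0; rewrite scaler0 addr0 scaleN1r addNr.
rewrite !eta_gen (pair_colP (erefl (x 0 0)) (erefl (x 1 0))).
by apply: pair_colP; rewrite !mxE /=; ring.
Qed.

Lemma cx_orthoproj_gen j k :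
  orthoproj (gaussian_part eps rho) (eta (u j k)) = pair_col (anti_coord j k) 0.
Proof.
rewrite (orthoproj_tri _ _ _ _ j) eta_gen flip_pair_col.
by apply: pair_colP; rewrite !mxE /=; field.
Qed.

(** Symmetry of the Gram matrix at (0, 1) would read ['i = - 'i]. Since the obstruction does not
    depend on the representation, [rho'] is arbitrary and the statement serves both (GC) and
    (LK). *)
Lemma eta_G_not_schurmann rho' psi :
  ~ is_schurmann_triple eps rho' (eta_G eps rho eta) psi.
Proof.
move=> /schurmann_gram_sym /(_ j0 j1).
have innerE j l k : inner (eta_G eps rho eta (u j k)) (eta_G eps rho eta (u l k)) =
    (anti_coord j k)^* * anti_coord l k.
  rewrite [LHS](_ : _ = inner (orthoproj (gaussian_part eps rho) (eta (u j k)))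
    (orthoproj (gaussian_part eps rho) (eta (u l k)))) //.
  by rewrite !cx_orthoproj_gen inner_pair_col mulr0 addr0.
under eq_bigr do rewrite innerE.
under [in RHS]eq_bigr do rewrite innerE.
rewrite (sum_ord3 (F := fun k => (anti_coord 0 k)^* * anti_coord 1 k)); last first.
  by move=> k; rewrite anti_coord3 mulr0.
rewrite (sum_ord3 (F := fun k => (anti_coord 1 k)^* * anti_coord 0 k)); last first.
  by move=> k; rewrite anti_coord3 mulr0.
rewrite /= conjC1 conjC0 conjCi !mulr0 !add0r mul1r mulr1 => /eqP.
by rewrite -subr_eq0 opprK -mulr2n mulrn_eq0 /= (negPf (neq0Ci C)).
Qed.

(** At the same pair of indices, the second coordinates would give [- 'i = 'i]. *)
Lemma eta_N_not_schurmann rho' psi :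
  ~ is_schurmann_triple eps rho' (eta_N eps rho eta) psi.
Proof.
move=> /schurmann_gram_sym /(_ j0 j1).
have innerE j l k : inner (eta_N eps rho eta (u j k)) (eta_N eps rho eta (u l k)) =
    (sym_coord j k)^* * sym_coord l k.
  rewrite [LHS](_ : _ =
    inner (eta (u j k) - orthoproj (gaussian_part eps rho) (eta (u j k)))
      (eta (u l k) - orthoproj (gaussian_part eps rho) (eta (u l k)))) //.
  have subE i : eta (u i k) - orthoproj (gaussian_part eps rho) (eta (u i k)) =
      pair_col 0 (sym_coord i k).
    rewrite cx_orthoproj_gen eta_gen.
    by apply: pair_colP; rewrite !mxE /= ?subrr ?subr0.
  by rewrite !subE inner_pair_col mulr0 add0r.
under eq_bigr do rewrite innerE.
under [in RHS]eq_bigr do rewrite innerE.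
rewrite (sum_ord3 (F := fun k => (sym_coord 0 k)^* * sym_coord 1 k)); last first.
  by move=> k; rewrite sym_coord3 mulr0.
rewrite (sum_ord3 (F := fun k => (sym_coord 1 k)^* * sym_coord 0 k)); last first.
  by move=> k; rewrite sym_coord3 mulr0.
rewrite /= conjC1 conjC0 rmorphN /= conjCi opprK !(mulr0, mul0r, addr0) mul1r mulr1.
move=> /eqP; rewrite eq_sym -subr_eq0 opprK -mulr2n mulrn_eq0 /=.
by rewrite (negPf (neq0Ci C)).
Qed.

(** * Failure of the three properties *)

Lemma not_GC : ~ property_GC eps.
Proof.
by move=> /(_ _ _ (eta_G_cocycle cx_cocycle)) [psi]; exact: eta_G_not_schurmann.
Qed.

Lemma not_NC : ~ property_NC eps.
Proof.
move=> /(_ _ _ _ (gaussian_set_rho_N eps rho) (eta_N_cocycle cx_cocycle)) [psi].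
exact: eta_N_not_schurmann.
Qed.

(** The sum of the two parts does have a generating functional, [tri_functional f]; a decomposition
    of it would complete the Gaussian part alone. *)
Lemma not_LK : ~ property_LK eps.
Proof.
move=> /(_ _ (tri_generating_functional f_eps) _ _ _ cx_associated_triple).
by case=> psi_G [psi_N [_ _ /eta_G_not_schurmann]].
Qed.

End Counterexample.

Theorem theorem3p10 (R : realType) (d : nat) (hd : (3 <= d)%N) :
  ~ property_GC (o_plus_counit (complex R) d) /\
  ~ property_NC (o_plus_counit (complex R) d) /\
  ~ property_LK (o_plus_counit (complex R) d).
Proof.
case: d hd => [|[|[|m]]] // _.
by split; [exact: not_GC | split; [exact: not_NC | exact: not_LK]].
Qed.
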